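(* Suppose $\hat K^0\in\mathcal K$, so that $C(\hat K^0)$ is finite. (Gauss--Newton case) For any stepsize $0<\eta\le \frac12$, the Gauss--Newton method $$\hat K^{n+1}=\hat K^n-2\eta\begin{bmatrix}\psi_1^nL_1(\hat K^n)&\cdots&\psi_{n_s}^nL_{n_s}(\hat K^n)\end{bmatrix},\qquad \psi_i^n=\left(R_i+B_i^T\mathcal E_i(P^{\hat K^n})B_i\right)^{-1},$$ is well defined (all iterates lie in $\mathcal K$) and converges to the global minimum $\hat K^*\in\mathcal K$ linearly as follows: for all $n\ge 0$, $$C(\hat K^n)-C(\hat K^* )\le\left(1-\frac{2\eta\mu}{\|\chi_{\hat K^*}\|}\right)^n\left(C(\hat K^0)-C(\hat K^* )\right).$$ (Natural policy gradient case) For any stepsize $$0<\eta\le\frac{1}{2\left(\|\hat R\|+\frac{\|\hat B\|^2C(\hat K^0)}{\mu}\right)},$$ the natural policy gradient method $$\hat K^{n+1}=\hat K^n-\eta\,\nabla C(\hat K^n)\,\chi_{\hat K^n}^{-1}$$ is well defined (all iterates lie in $\mathcal K$) and converges to the global minimum $\hat K^*\in\mathcal K$ linearly as follows: for all $n\ge0$, $$C(\hat K^n)-C(\hat K^* )\le\left(1-\frac{2\eta\mu\,\sigma_{\min}(\hat R)}{\|\chi_{\hat K^*}\|}\right)^n\left(C(\hat K^0)-C(\hat K^* )\right).$$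
   Context: Setting. Consider the Markovian jump linear system $x_{t+1}=A_{\omega(t)}x_t+B_{\omega(t)}u_t$, $t=0,1,2,\dots$, with $x_t\in\mathbb R^d$, $u_t\in\mathbb R^k$, $A_i\in\mathbb R^{d\times d}$, $B_i\in\mathbb R^{d\times k}$ for $i\in\Omega=\{1,\dots,n_s\}$. Here $\omega(t)$ is a Markov chain on $\Omega$ with transition probabilities $p_{ij}=\mathbb P(\omega(t+1)=j\mid\omega(t)=i)$ and initial distribution $\rho=(\rho_1,\dots,\rho_{n_s})$. The initial state $x_0\sim\mathcal D$ has finite second moment and is independent of the chain. Let $Q_i\succ0$ ($d\times d$) and $R_i\succ0$ ($k\times k$) be symmetric. Standing assumptions: $\rho_i>0$ for all $i$ and $\mathbb E[x_0x_0^T]\succ0$. Policies. A policy is $\hat K=\begin{bmatrix}K_1&\cdots&K_{n_s}\end{bmatrix}$ with $K_i\in\mathbb R^{k\times d}$, acting by $u_t=-K_{\omega(t)}x_t$. $\mathcal K$ denotes the set of policies that stabilize the closed loop in the mean square sense, i.e. $\mathbb E[\|x_t\|^2]\to0$ for every initial state and every initial mode distribution. The cost is $$C(\hat K)=\mathbb E_{x_0\sim\mathcal D,\,\omega(0)\sim\rho}\Big[\sum_{t=0}^\infty x_t^TQ_{\omega(t)}x_t+u_t^TR_{\omega(t)}u_t\Big].$$ It is finite and differentiable on $\mathcal K$. The gradient $\nabla C(\hat K)\in\mathbb R^{k\times dn_s}$ is taken with respect to the trace inner product, i.e. $dC(\hat K)=\mathrm{tr}(d\hat K^T\nabla C(\hat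 K))$. Notation. For a family $P=(P_j)_{j\in\Omega}$, $\mathcal E_i(P)=\sum_{j=1}^{n_s}p_{ij}P_j$. For $\hat K\in\mathcal K$, $P^{\hat K}=(P_i^{\hat K})_{i\in\Omega}$ is the solution of $P_i^{\hat K}=Q_i+K_i^TR_iK_i+(A_i-B_iK_i)^T\mathcal E_i(P^{\hat K})(A_i-B_iK_i)$, $i\in\Omega$. Put $L_i(\hat K)=(R_i+B_i^T\mathcal E_i(P^{\hat K})B_i)K_i-B_i^T\mathcal E_i(P^{\hat K})A_i$. With $X_i(t)=\mathbb E[x_tx_t^T\mathbf 1_{\omega(t)=i}]$ along the closed loop of $\hat K$ (so $X_i(0)=\rho_i\mathbb E[x_0x_0^T]$), put $\chi_{\hat K}=\mathrm{diag}\big(\sum_{t\ge0}X_1(t),\dots,\sum_{t\ge0}X_{n_s}(t)\big)$ (block diagonal). $\hat K^*=[K_1^*\ \cdots\ K_{n_s}^*]$ denotes the optimal policy (global minimizer of $C$ over $\mathcal K$), given by $K_i^*=(R_i+B_i^T\mathcal E_i(P)B_i)^{-1}B_i^T\mathcal E_i(P)A_i$, where $(P_i)$ is the unique positive definite solution of the coupled Riccati equations $P_i=Q_i+A_i^T\mathcal E_i(P)A_i-A_i^T\mathcal E_i(P)B_i(R_i+B_i^T\mathcal E_i(P)B_i)^{-1}B_i^T\mathcal E_i(P)A_i$. $\hat R=\mathrm{diag}(R_1,\dots,R_{n_s})$, $\hat B=\mathrm{diag}(B_1,\dots,B_{n_s})$ (block diagonal), $\mu=\min_{i\in\Omega}(\rho_i)\,\sigma_{\min}(\mathbb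 E[x_0x_0^T])$; $\|\cdot\|$ is the spectral norm and $\sigma_{\min}$ the minimum singular value. *)

(* Defs.v *)
From HB Require Import structures.
From mathcomp Require Import all_boot all_order all_algebra.
From mathcomp Require Import all_classical all_reals all_analysis.
Set Implicit Arguments.
Unset Strict Implicit.
Unset Printing Implicit Defensive.
Import Order.TTheory GRing.Theory Num.Theory.
Import numFieldNormedType.Exports.
Local Open Scope classical_set_scope.
Local Open Scope ring_scope.

Section linear_algebra.
Variable R : realType.

Definition quad n (M : 'M[R]_n) (v : 'cV[R]_n) : R := (v^T *m M *m v) 0 0.

(* Squared Euclidean norm; the library norm `|v| on matrices is the sup norm. *)
Definition sqnorm n (v : 'cV[R]_n) : R := \sum_i v i 0 ^+ 2.

Definition posdef n (M : 'M[R]_n) : Prop :=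
  M^T = M /\ forall v : 'cV[R]_n, v != 0 -> 0 < quad M v.

(* Square roots of the eigenvalues of M^T M.  For a matrix with more columns
   than rows this contains an additional 0, so sigma_min below is restricted to
   square matrices. *)
Definition singular_values m n (M : 'M[R]_(m, n)) : set R :=
  [set s | 0 <= s /\ eigenvalue (M^T *m M) (s ^+ 2)].

Definition spectral_norm m n (M : 'M[R]_(m, n)) : R := sup (singular_values M).

Definition sigma_min n (M : 'M[R]_n) : R := inf (singular_values M).

(* The G such that df(K)(H) = tr(H^T G) for all H; it has this property, and is
   unique, when f is differentiable at K. *)
Definition gradient m n (f : 'M[R]_(m, n) -> R) (K : 'M[R]_(m, n)) :
    'M[R]_(m, n) :=
  xget 0 [set G | forall H, 'd f K H = \tr (H^T *m G)].

End linear_algebra.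

Record mjls (R : realType) (d k ns : nat) := Mjls {
  dynA : 'I_ns -> 'M[R]_d ;
  dynB : 'I_ns -> 'M[R]_(d, k) ;
  costQ : 'I_ns -> 'M[R]_d ;
  costR : 'I_ns -> 'M[R]_k ;
  trans : 'I_ns -> 'I_ns -> R }.

Definition stochastic (R : realType) ns (p : 'I_ns -> 'I_ns -> R) : Prop :=
  (forall i j, 0 <= p i j) /\ (forall i, \sum_j p i j = 1).

(* A policy is the block row [K_1 ... K_ns]; gain K i is K_i. *)
Definition gain (R : realType) d k ns (K : 'M[R]_(k, \sum_(i < ns) d))
    (i : 'I_ns) : 'M[R]_(k, d) :=
  submxrow K i.

Section probabilistic_setting.
Context (R : realType) (disp : measure_display) (T : measurableType disp).
Variable P : probability T R.

(* Time-homogeneous Markov chain with initial distribution nu and transition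
   matrix p; the Markov property is multiplied out, so that conditioning events
   of probability zero need no convention. *)
Definition markov_chain ns (w : nat -> T -> 'I_ns) (nu : 'I_ns -> R)
    (p : 'I_ns -> 'I_ns -> R) : Prop :=
  [/\ forall t i, measurable [set s | w t s = i],
      forall i, P [set s | w 0 s = i] = (nu i)%:E
    & forall t (h : nat -> 'I_ns) j,
        P [set s | (forall r, (r <= t)%N -> w r s = h r) /\ w t.+1 s = j]
        = (P [set s | forall r, (r <= t)%N -> w r s = h r] * (p (h t) j)%:E)%E].

Definition measurable_state d (x : T -> 'cV[R]_d) : Prop :=
  forall a, measurable_fun setT (fun s => x s a 0).

Definition finite_second_moment d (x : T -> 'cV[R]_d) : Prop :=
  ('E_P[fun s => sqnorm (x s)] < +oo)%E.

Definition second_moment d (x : T -> 'cV[R]_d) : 'M[R]_d :=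
  \matrix_(a, b) fine ('E_P[fun s => (x s *m (x s)^T) a b])%E.

Definition sigma_state d (x : T -> 'cV[R]_d) : set (set T) :=
  <<s [set E | exists (a : 'I_d) (U : set R),
         measurable U /\ E = [set s | U (x s a 0)]] >>.

Definition sigma_chain ns (w : nat -> T -> 'I_ns) : set (set T) :=
  <<s [set E | exists t i, E = [set s | w t s = i]] >>.

Definition independent_of_chain d ns (x : T -> 'cV[R]_d)
    (w : nat -> T -> 'I_ns) : Prop :=
  forall E F, sigma_state x E -> sigma_chain w F ->
    P (E `&` F) = (P E * P F)%E.

End probabilistic_setting.

Section closed_loop.
Context (R : realType) (d k ns : nat).
Variables (sys : mjls R d k ns) (K : 'M[R]_(k, \sum_(i < ns) d)).

Definition control (i : 'I_ns) (x : 'cV[R]_d) : 'cV[R]_k := - (gain K i *m x).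

Fixpoint state (x0 : 'cV[R]_d) (w : nat -> 'I_ns) (t : nat) : 'cV[R]_d :=
  if t is r.+1 then
    dynA sys (w r) *m state x0 w r
      + dynB sys (w r) *m control (w r) (state x0 w r)
  else x0.

Definition stage_cost (i : 'I_ns) (x : 'cV[R]_d) : R :=
  quad (costQ sys i) x + quad (costR sys i) (control i x).

(* Mean square stability: every deterministic initial state and every initial
   mode distribution, on whatever probability space carries the chain. *)
Definition ms_stabilizing : Prop :=
  forall (disp : measure_display) (T : measurableType disp)
    (P : probability T R) (w : nat -> T -> 'I_ns) (nu : 'I_ns -> R)
    (x0 : 'cV[R]_d),
  markov_chain P w nu (trans sys) ->
  ('E_P[fun s => sqnorm (state x0 (w^~ s) t)])%E @[t --> \oo] --> 0%E.

Definition coupling (P : 'I_ns -> 'M[R]_d) (i : 'I_ns) : 'M[R]_d :=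
  \sum_j trans sys i j *: P j.

Definition closedA (i : 'I_ns) : 'M[R]_d :=
  dynA sys i - dynB sys i *m gain K i.

Definition lyapunov_solution (P : 'I_ns -> 'M[R]_d) : Prop :=
  forall i, P i = costQ sys i + (gain K i)^T *m costR sys i *m gain K i
                  + (closedA i)^T *m coupling P i *m closedA i.

(* The solution is unique when K is mean square stabilizing. *)
Definition valueP : 'I_ns -> 'M[R]_d :=
  xget (fun=> 0) [set P | lyapunov_solution P].

Definition gramR (P : 'I_ns -> 'M[R]_d) (i : 'I_ns) : 'M[R]_k :=
  costR sys i + (dynB sys i)^T *m coupling P i *m dynB sys i.

Definition gradL (i : 'I_ns) : 'M[R]_(k, d) :=
  gramR valueP i *m gain K i
    - (dynB sys i)^T *m coupling valueP i *m dynA sys i.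

End closed_loop.

Section cost.
Context (R : realType) (d k ns : nat).
Context (disp : measure_display) (T : measurableType disp).
Variables (P : probability T R) (x0 : T -> 'cV[R]_d) (w : nat -> T -> 'I_ns).
Variable sys : mjls R d k ns.
Implicit Type K : 'M[R]_(k, \sum_(i < ns) d).

Definition trajectory K (t : nat) (s : T) : 'cV[R]_d :=
  state sys K (x0 s) (w^~ s) t.

Definition cost K : \bar R :=
  (\int[P]_s \sum_(0 <= t <oo)
     (stage_cost sys K (w t s) (trajectory K t s))%:E)%E.

Definition rcost K : R := fine (cost K).

Definition momentX K (i : 'I_ns) (t : nat) : 'M[R]_d :=
  \matrix_(a, b) fine ('E_P[fun s =>
    ((trajectory K t s *m (trajectory K t s)^T) a b * (w t s == i)%:R)%R])%E.

Definition chi K : 'M[R]_(\sum_(i < ns) d) :=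
  \mxdiag_(i < ns) limn (series (momentX K i)).

Definition mu_const (rho : 'I_ns -> R) : R :=
  inf (range rho) * sigma_min (second_moment P x0).

Definition npg_step (eta : R) K : 'M[R]_(k, \sum_(i < ns) d) :=
  K - eta *: (gradient rcost K *m invmx (chi K)).

End cost.

Section optimum.
Context (R : realType) (d k ns : nat).
Variable sys : mjls R d k ns.

Definition gn_step (eta : R) (K : 'M[R]_(k, \sum_(i < ns) d)) :
    'M[R]_(k, \sum_(i < ns) d) :=
  K - (2 * eta) *: \mxrow_(i < ns)
        (invmx (gramR sys (valueP sys K) i) *m gradL sys K i).

Definition riccati_solution (P : 'I_ns -> 'M[R]_d) : Prop :=
  forall i,
    let E := coupling sys P i in
    let A := dynA sys i in
    let B := dynB sys i in
    P i = costQ sys i + A^T *m E *m A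
          - A^T *m E *m B *m invmx (costR sys i + B^T *m E *m B)
              *m B^T *m E *m A.

(* The positive definite solution exists and is unique as soon as some policy
   is mean square stabilizing and all costQ i, costR i are positive definite. *)
Definition riccatiP : 'I_ns -> 'M[R]_d :=
  xget (fun=> 0) [set P | (forall i, posdef (P i)) /\ riccati_solution P].

Definition optK : 'M[R]_(k, \sum_(i < ns) d) :=
  \mxrow_(i < ns)
    (invmx (gramR sys riccatiP i) *m (dynB sys i)^T
       *m coupling sys riccatiP i *m dynA sys i).

Definition hatR : 'M[R]_(\sum_(i < ns) k) := \mxdiag_(i < ns) costR sys i.

Definition hatB : 'M[R]_(\sum_(i < ns) d, \sum_(j < ns) k) :=
  \mxblock_(i < ns, j < ns) (if i == j then dynB sys i else 0).

End optimum.

(* Main.v *)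
Require Import Defs.
From HB Require Import structures.
From mathcomp Require Import all_boot all_order all_algebra.
From mathcomp Require Import all_classical all_reals all_analysis.
From mathcomp Require Import measurable_realfun ring lra.
Import Order.TTheory GRing.Theory Num.Theory.
Import numFieldNormedType.Exports.
Local Open Scope classical_set_scope.
Local Open Scope ring_scope.

(** Everything is expressed through families of symmetric matrices indexed by
    the modes.  For a policy K, back is the operator F |-> A_i^T E_i(F) A_i of
    the closed loop and fwd its adjoint, which propagates the mode-wise second
    moments X_i(t); the independence of the initial state from the chain and
    the Markov property give E[x_t^T F_(w t) x_t] as the pairing of back^t F
    with the initial moments (mean_quad_state).  Mean square stability therefore
    means that the iterates of back vanish (ms_stable, stable_ms).  For a
    stabilizing policy this makes 1 - back and 1 - fwd invertible, identifies
    the cost with the pairing of the value P^K with the initial moments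
    (cost_pairing), and gives the blocks S_i of chi_K as the solution of
    S = X(0) + fwd S (occupation_fix).

    The core is an exact formula for the difference of the costs of two policies
    (cost_difference): with H = K' - K and G_i = R_i + B_i^T E_i(P^K) B_i,
    C(K') - C(K) is the pairing of the occupation of K', not of K, with
    H_i^T L_i + L_i^T H_i + H_i^T G_i H_i.  It has three consequences.
    - If this quadratic polynomial in H is nonpositive, P^K is a Lyapunov
      function for K', so that K' is stabilizing (improve_stable).
    - Completing the square bounds it below by - L_i^T G_i^-1 L_i.  With K' the
      optimal policy this bounds the gap C(K) - C(K star) by the norm of chi at
      the optimum times the traces of L_i^T G_i^-1 L_i (gradient domination).
    - For the two methods H_i is a negative multiple of G_i^-1 L_i or of L_i, and
      the polynomial is at most - 2 eta times L_i^T G_i^-1 L_i or L_i^T L_i.  As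
      the occupation of K' is at least mu, the cost decreases by at least 2 eta mu
      times the traces of these matrices.
    The last two estimates together are the linear rate (descent); for the
    natural gradient, G_i >= R_i >= sigma_min(R) compares the two traces.  The
    bound on
    the step size of the natural gradient method refers to the initial cost,
    which bounds the cost of all later iterates, hence their values and G_i.

    The optimal policy is built by value iteration started at the value of a
    stabilizing policy, which decreases to a solution of the Riccati equations
    (riccati_exists).  Since L vanishes at the optimum, the difference formula
    there is a positive definite quadratic form in K - K star, so that it proves
    optimality, and convergence of the costs implies convergence of the policies
    (gap_lower).

    For the gradient, the difference formula is used with the two policies
    exchanged: the occupation is then that of the fixed policy K, and only the
    value of K + H varies, by O(|H|) according to the comparison principle
    (value_perturb).  The linear part identifies the gradient as
    2 [L_1 ... L_ns] chi_K (cost_gradient), so that the natural gradient step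
    subtracts 2 eta L_i from K_i. *)

Set Implicit Arguments.
Unset Strict Implicit.
Unset Printing Implicit Defensive.

(** * Quadratic forms, matrix norms and singular values *)

Section forms.
Variable R : realType.

Definition bform n (M : 'M[R]_n) (u v : 'cV[R]_n) : R := (u^T *m M *m v) 0 0.

Definition psd n (M : 'M[R]_n) : Prop :=
  M^T = M /\ forall v : 'cV[R]_n, 0 <= quad M v.

(** A submultiplicative norm that is elementary to compute with, for the
    estimates in which the value of the constant does not matter. *)
Definition l1 m n (M : 'M[R]_(m, n)) : R := \sum_i \sum_j `|M i j|.

Lemma bformE n (M : 'M[R]_n) u v :
  bform M u v = \sum_i \sum_j u i 0 * M i j * v j 0.
Proof.
rewrite /bform mxE exchange_big /=; apply: eq_bigr => j _.
by rewrite mxE mulr_suml; apply: eq_bigr => i _; rewrite mxE.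
Qed.

Lemma quad_tr n (M : 'M[R]_n) v : quad M v = \tr (M *m (v *m v^T)).
Proof. by rewrite mulmxA mxtrace_mulC mulmxA /quad /mxtrace big_ord1. Qed.

Lemma bformD n (M N : 'M[R]_n) u v : bform (M + N) u v = bform M u v + bform N u v.
Proof. by rewrite /bform mulmxDr mulmxDl mxE. Qed.

Lemma bformZ n a (M : 'M[R]_n) u v : bform (a *: M) u v = a * bform M u v.
Proof. by rewrite /bform -scalemxAr -scalemxAl mxE. Qed.

Lemma bform0 n u v : bform (0 : 'M[R]_n) u v = 0.
Proof. by rewrite /bform mulmx0 mul0mx mxE. Qed.

Lemma bform_sum n I (r : seq I) (P : pred I) (F : I -> 'M[R]_n) u v :
  bform (\sum_(i <- r | P i) F i) u v = \sum_(i <- r | P i) bform (F i) u v.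
Proof.
by apply: (big_morph (fun M => bform M u v)) => [M N|]; rewrite ?bformD ?bform0.
Qed.

Lemma bform_congr m n (M : 'M[R]_m) (A : 'M[R]_(m, n)) u v :
  bform (A^T *m M *m A) u v = bform M (A *m u) (A *m v).
Proof. by rewrite /bform trmx_mul !mulmxA. Qed.

Lemma bform_trmx n (M : 'M[R]_n) u v : bform M^T u v = bform M v u.
Proof.
rewrite /bform; have -> : u^T *m M^T *m v = (v^T *m M *m u)^T.
  by rewrite !trmx_mul trmxK mulmxA.
by rewrite mxE.
Qed.

Lemma bform_delta n (M : 'M[R]_n) i j :
  bform M (delta_mx i 0) (delta_mx j 0) = M i j.
Proof.
rewrite /bform trmx_delta -rowE mxE (bigD1 j) //= big1 => [|k kj].
  by rewrite !mxE !eqxx mulr1 addr0.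
by rewrite !mxE (negPf kj) mulr0.
Qed.

Lemma quadE n (M : 'M[R]_n) v : quad M v = bform M v v. Proof. by []. Qed.

Lemma quadD n (M N : 'M[R]_n) v : quad (M + N) v = quad M v + quad N v.
Proof. exact: bformD. Qed.

Lemma quadZ n a (M : 'M[R]_n) v : quad (a *: M) v = a * quad M v.
Proof. exact: bformZ. Qed.

Lemma quadN n (M : 'M[R]_n) v : quad (- M) v = - quad M v.
Proof. by rewrite -scaleN1r quadZ mulN1r. Qed.

Lemma quadB n (M N : 'M[R]_n) v : quad (M - N) v = quad M v - quad N v.
Proof. by rewrite quadD quadN. Qed.

Lemma quad0 n v : quad (0 : 'M[R]_n) v = 0.
Proof. exact: bform0. Qed.

Lemma quad_sum n I (r : seq I) (P : pred I) (F : I -> 'M[R]_n) v :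
  quad (\sum_(i <- r | P i) F i) v = \sum_(i <- r | P i) quad (F i) v.
Proof. exact: bform_sum. Qed.

Lemma quad_congr m n (M : 'M[R]_m) (A : 'M[R]_(m, n)) v :
  quad (A^T *m M *m A) v = quad M (A *m v).
Proof. exact: bform_congr. Qed.

Lemma quad1 n (v : 'cV[R]_n) : quad 1%:M v = sqnorm v.
Proof.
rewrite /quad mulmx1 mxE; apply: eq_bigr => i _.
by rewrite mxE expr2.
Qed.

Lemma quad_gram m n (A : 'M[R]_(m, n)) v : quad (A^T *m A) v = sqnorm (A *m v).
Proof. by rewrite -quad1 -quad_congr mulmx1. Qed.

Lemma sqnorm_ge0 n (v : 'cV[R]_n) : 0 <= sqnorm v.
Proof. by apply: sumr_ge0 => i _; exact: sqr_ge0. Qed.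

Lemma sqnorm_eq0 n (v : 'cV[R]_n) : sqnorm v = 0 -> v = 0.
Proof.
move=> /eqP; rewrite psumr_eq0 => [|i _]; last exact: sqr_ge0.
move=> /allP h; apply/matrixP => i j; rewrite ord1 mxE.
by have := h i (mem_index_enum i); rewrite /= sqrf_eq0 => /eqP.
Qed.

Lemma sqnorm_gt0 n (v : 'cV[R]_n) : v != 0 -> 0 < sqnorm v.
Proof.
move=> v0; rewrite lt0r sqnorm_ge0 andbT; apply: contra v0 => /eqP h.
by apply/eqP/sqnorm_eq0.
Qed.

Lemma quadDv n (M : 'M[R]_n) (t : R) u v : M^T = M ->
  quad M (u + t *: v) = quad M u + 2 * t * bform M u v + t ^+ 2 * quad M v.
Proof.
move=> sM; have e : bform M v u = bform M u v by rewrite -bform_trmx sM.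
move: e; rewrite /quad /bform; have -> : (u + t *: v)^T = u^T + t *: v^T.
  by rewrite linearD linearZ.
rewrite !mulmxDl !mulmxDr.
rewrite -!scalemxAl -!scalemxAr !mxE => ->; ring.
Qed.

Lemma quadZv n (M : 'M[R]_n) (t : R) v : quad M (t *: v) = t ^+ 2 * quad M v.
Proof.
rewrite /quad; have -> : (t *: v)^T = t *: v^T by rewrite linearZ.
rewrite -!scalemxAl -!scalemxAr !mxE; ring.
Qed.

(** Cauchy--Schwarz: the quadratic polynomial t |-> quad M (u + t v) never
    becomes negative. *)
Lemma psd_bform_le n (M : 'M[R]_n) u v : psd M ->
  bform M u v ^+ 2 <= quad M u * quad M v.
Proof.
move=> [sM pM]; set b := bform M u v.
have h t : 0 <= quad M u + 2 * t * b + t ^+ 2 * quad M v by rewrite -quadDv.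
(* The polynomial is minimal at t = - b / quad M v; when quad M v = 0 it is
   affine, and the second witness would give it the value -1. *)
have := pM v; rewrite le0r => /orP[/eqP v0|v0].
  have [b0|b0] := eqVneq b 0; first by rewrite b0 v0 mulr0 expr0n.
  have := h (- (quad M u + 1) / (2 * b)); rewrite v0.
  have -> : quad M u + 2 * (- (quad M u + 1) / (2 * b)) * b
     + (- (quad M u + 1) / (2 * b)) ^+ 2 * 0 = -1 by field.
  lra.
have := h (- b / quad M v).
have -> : quad M u + 2 * (- b / quad M v) * b + (- b / quad M v) ^+ 2 * quad M v
   = (quad M u * quad M v - b ^+ 2) / quad M v by field; rewrite gt_eqF.
by rewrite pmulr_lge0 ?invr_gt0 // subr_ge0.
Qed.

Lemma psd_row0 n (M : 'M[R]_n) i j : psd M -> M i i = 0 -> M i j = 0.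
Proof.
move=> pM Mi; have := psd_bform_le (delta_mx i 0) (delta_mx j 0) pM.
rewrite !quadE !bform_delta Mi mul0r => h; apply/eqP; rewrite -sqrf_eq0.
by rewrite eq_le h sqr_ge0.
Qed.

End forms.

Section l1norm.
Variable R : realType.

Lemma l1_ge0 m n (M : 'M[R]_(m, n)) : 0 <= l1 M.
Proof. by apply: sumr_ge0 => i _; apply: sumr_ge0. Qed.

Lemma l1_trmx m n (M : 'M[R]_(m, n)) : l1 M^T = l1 M.
Proof.
rewrite /l1 exchange_big; apply: eq_bigr => i _; apply: eq_bigr => j _.
by rewrite mxE.
Qed.

Lemma l1M m n p (M : 'M[R]_(m, n)) (N : 'M[R]_(n, p)) :
  l1 (M *m N) <= l1 M * l1 N.
Proof.
have -> : l1 M * l1 N = \sum_i \sum_k `|M i k| * l1 N.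
  by rewrite mulr_suml; apply: eq_bigr => i _; rewrite mulr_suml.
apply: ler_sum => i _.
apply: (@le_trans _ _ (\sum_k \sum_j `|M i k| * `|N k j|)).
  rewrite exchange_big; apply: ler_sum => j _; rewrite mxE.
  apply: le_trans (ler_norm_sum _ _ _) _; apply: ler_sum => k _.
  by rewrite normrM.
apply: ler_sum => k _; rewrite -mulr_sumr ler_wpM2l //.
rewrite /l1 (bigD1 k) //= lerDl sumr_ge0 // => l _; exact: sumr_ge0.
Qed.

Lemma entry_le_norm m n (M : 'M[R]_(m, n)) i j : `|M i j| <= `|M|.
Proof.
rewrite [leRHS]mx_normrE.
exact: (le_bigmax _ (fun x : 'I_m * 'I_n => `|M x.1 x.2|) (i, j)).
Qed.

Lemma l1_le_norm m n (M : 'M[R]_(m, n)) : l1 M <= (m * n)%:R * `|M|.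
Proof.
apply: (@le_trans _ _ (\sum_(i < m) \sum_(j < n) `|M|)).
  apply: ler_sum => i _; apply: ler_sum => j _.
  exact: entry_le_norm.
by rewrite !sumr_const !card_ord -mulrnA mulr_natl mulnC.
Qed.

(** Entrywise, |u_i v_j| <= (u_i^2 + v_j^2) / 2. *)
Lemma norm_bform_le n (M : 'M[R]_n) u v :
  `|bform M u v| <= l1 M * (sqnorm u + sqnorm v).
Proof.
rewrite bformE /l1 mulr_suml.
apply: le_trans (ler_norm_sum _ _ _) _; apply: ler_sum => i _.
rewrite mulr_suml; apply: le_trans (ler_norm_sum _ _ _) _.
apply: ler_sum => j _; rewrite !normrM [X in X * _]mulrC -mulrA ler_wpM2l //.
have hi (x : 'cV[R]_n) k : x k 0 ^+ 2 <= sqnorm x.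
  by rewrite /sqnorm (bigD1 k) //= lerDl sumr_ge0 // => l _; exact: sqr_ge0.
have := hi u i; have := hi v j.
rewrite -[u i 0 ^+ 2]real_normK ?num_real // -[v j 0 ^+ 2]real_normK ?num_real //.
have := sqr_ge0 (`|u i 0| - `|v j 0|); rewrite sqrrB.
have := sqr_ge0 (`|u i 0| + `|v j 0|); rewrite sqrrD; lra.
Qed.

Lemma norm_quad_le n (M : 'M[R]_n) v : `|quad M v| <= 2 * l1 M * sqnorm v.
Proof.
have := norm_bform_le M v v; rewrite -quadE => /le_trans; apply.
by rewrite mulrDr mulrAC -mulr2n mulr_natl mulrnAl mulrC.
Qed.

Lemma quad_le n (M : 'M[R]_n) v : quad M v <= 2 * l1 M * sqnorm v.
Proof. exact: le_trans (ler_norm _) (norm_quad_le M v). Qed.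

Lemma norm_tr_le n (M : 'M[R]_n) : `|\tr M| <= l1 M.
Proof.
apply: le_trans (ler_norm_sum _ _ _) _; apply: ler_sum => i _.
by rewrite (bigD1 i) //= lerDl sumr_ge0.
Qed.

End l1norm.

Section spectrum.
Variable R : realType.

(** A positive semidefinite N that is invertible is bounded below on the unit
    sphere: |N v|^2 is at most a multiple of quad N v by Cauchy--Schwarz, and
    |v| at most a multiple of |N v|. *)
Lemma psd_unit_lower n (N : 'M[R]_n) : psd N -> N \in unitmx ->
  exists2 c, 0 < c & forall v, sqnorm v <= c * quad N v.
Proof.
move=> pN uN; pose V := invmx N.
exists ((2 * l1 (V^T *m V)) * (2 * l1 N) + 1).
  by rewrite ltr_wpDl // !mulr_ge0 ?l1_ge0.
move=> v; have q0 := pN.2 v.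
have h1 : sqnorm (N *m v) <= 2 * l1 N * quad N v.
  have := psd_bform_le (N *m v) v pN.
  rewrite {1}/bform trmx_mul pN.1.
  have -> : v^T *m N *m N *m v = v^T *m (N^T *m N) *m v.
    by rewrite pN.1 !mulmxA.
  rewrite -/(quad _ _) quad_gram => h.
  have h2 := le_trans h (ler_wpM2r q0 (quad_le N (N *m v))).
  have := sqnorm_ge0 (N *m v); rewrite le0r => /orP[/eqP ->|s0].
    by rewrite !mulr_ge0 ?l1_ge0.
  rewrite -(ler_pM2l s0) -expr2; apply: le_trans h2 _.
  by rewrite le_eqVlt; apply/orP; left; apply/eqP; ring.
have h2 : sqnorm v <= 2 * l1 (V^T *m V) * sqnorm (N *m v).
  have := quad_le (V^T *m V) (N *m v).
  by rewrite quad_gram mulmxA mulVmx // mul1mx.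
apply: le_trans h2 _.
apply: (@le_trans _ _ (2 * l1 (V^T *m V) * (2 * l1 N) * quad N v)).
  2: by rewrite ler_wpM2r // lerDl.
rewrite -[leRHS]mulrA ler_wpM2l //; by rewrite mulr_ge0 ?l1_ge0.
Qed.

Lemma eigenvalue_det n (M : 'M[R]_n) a :
  eigenvalue M a <-> (a%:M - M) \notin unitmx.
Proof.
split=> [/eigenvalueP[v vM v0]|].
  rewrite unitmxE unitfE negbK; apply/det0P; exists v => //.
  by rewrite mulmxBr vM mul_mx_scalar subrr.
rewrite unitmxE unitfE negbK => /det0P[v v0 h]; apply/eigenvalueP; exists v => //.
by apply/esym/eqP; rewrite -subr_eq0 -h mulmxBr mul_mx_scalar.
Qed.

(** The supremum lam of the bform over the unit sphere is an eigenvalue: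
    lam - M is positive semidefinite, and were it invertible, its bform would be
    bounded below on the sphere and lam would not be the supremum. *)
Lemma sym_max_eigenvalue n (M : 'M[R]_n) : (0 < n)%N -> M^T = M ->
  exists2 lam, eigenvalue M lam & forall v, quad M v <= lam * sqnorm v.
Proof.
case: n M => // n M _ sM.
pose S := [set x | exists2 v : 'cV[R]_n.+1, sqnorm v = 1 & x = quad M v].
have hS : has_sup S.
  split.
    exists (quad M (delta_mx 0 0)), (delta_mx 0 0) => //.
    by rewrite -quad1 quadE bform_delta mxE eqxx.
  exists (2 * l1 M) => _ [v v1 ->].
  by have := quad_le M v; rewrite v1 mulr1.
have hle v : quad M v <= sup S * sqnorm v.
  have [->|v0] := eqVneq v 0.
    by rewrite /quad mulmx0 mxE -quad1 /quad mulmx0 mxE mulr0.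
  have s0 := sqnorm_gt0 v0; set s := sqnorm v in s0 *.
  pose u := (Num.sqrt s)^-1 *: v.
  have e : (Num.sqrt s)^-1 ^+ 2 = s^-1 by rewrite exprVn sqr_sqrtr ?ltW.
  have : S (quad M u).
    by exists u => //; rewrite -quad1 quadZv e quad1 mulVf // gt_eqF.
  move/(ub_le_sup hS.2); rewrite quadZv e => h.
  by rewrite -ler_pdivrMr // mulrC.
exists (sup S) => //; apply/eigenvalue_det/negP => uN.
have pN : psd ((sup S)%:M - M).
  split; first by rewrite linearB /= tr_scalar_mx sM.
  by move=> v; rewrite quadB -scalemx1 quadZ quad1 subr_ge0.
have [c c0 hc] := psd_unit_lower pN uN.
have : sup S <= sup S - c^-1.
  apply: ge_sup hS.1 _ => _ [v v1 ->].
  have := hc v; rewrite quadB -scalemx1 quadZ quad1 v1 mulr1.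
  rewrite -ler_pdivrMl // mulr1; lra.
by have : 0 < c^-1 by [rewrite invr_gt0]; lra.
Qed.

Lemma sym_min_eigenvalue n (M : 'M[R]_n) : (0 < n)%N -> M^T = M ->
  exists2 lam, eigenvalue M lam & forall v, lam * sqnorm v <= quad M v.
Proof.
move=> n0 sM; have sN : (- M)^T = - M by rewrite linearN /= sM.
have [lam h1 h2] := sym_max_eigenvalue n0 sN.
exists (- lam); last by move=> v; have := h2 v; rewrite quadN; lra.
have /eigenvalueP[v vM v0] := h1; apply/eigenvalueP; exists v => //.
by rewrite scaleNr -vM mulmxN opprK.
Qed.

Lemma sym_eigenvector n (M : 'M[R]_n) a : M^T = M -> eigenvalue M a ->
  exists2 v : 'cV_n, v != 0 & M *m v = a *: v.
Proof.
move=> sM /eigenvalueP[v vM v0]; exists v^T; first by rewrite trmx_eq0.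
by rewrite -{1}sM -trmx_mul vM linearZ.
Qed.

Lemma posdef_sym n (M : 'M[R]_n) : posdef M -> M^T = M.
Proof. by case. Qed.

Lemma posdef_psd n (M : 'M[R]_n) : posdef M -> psd M.
Proof.
move=> [sM pM]; split=> // v.
have [->|v0] := eqVneq v 0; first by rewrite /quad mulmx0 mxE.
exact/ltW/pM.
Qed.

Lemma posdef_unit n (M : 'M[R]_n) : posdef M -> M \in unitmx.
Proof.
move=> [sM pM]; rewrite unitmxE unitfE; apply/negP => /det0P[v v0 h].
have := pM v^T; rewrite trmx_eq0 => /(_ v0).
by rewrite /quad trmxK h mul0mx mxE ltxx.
Qed.

Lemma posdef_inv n (M : 'M[R]_n) : posdef M -> posdef (invmx M).
Proof.
move=> pM; have uM := posdef_unit pM; have [sM hM] := pM.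
have sI : (invmx M)^T = invmx M by rewrite trmx_inv sM.
split=> // v v0.
have -> : quad (invmx M) v = quad M (invmx M *m v).
  by rewrite -quad_congr sI mulVmx // mul1mx.
apply: hM; apply: contra v0 => /eqP h.
by rewrite -[v]mul1mx -(mulmxV uM) -mulmxA h mulmx0.
Qed.

Lemma posdef_lower n (M : 'M[R]_n) : posdef M ->
  exists2 e, 0 < e & forall v, e * sqnorm v <= quad M v.
Proof.
move=> pM; have [c c0 hc] := psd_unit_lower (posdef_psd pM) (posdef_unit pM).
exists c^-1; first by rewrite invr_gt0.
by move=> v; rewrite ler_pdivrMl.
Qed.

Lemma psdD n (M N : 'M[R]_n) : psd M -> psd N -> psd (M + N).
Proof.
move=> [sM pM] [sN pN]; split; first by rewrite linearD /= sM sN.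
by move=> v; rewrite quadD addr_ge0.
Qed.

Lemma psdZ n a (M : 'M[R]_n) : 0 <= a -> psd M -> psd (a *: M).
Proof.
move=> a0 [sM pM]; split; first by rewrite linearZ /= sM.
by move=> v; rewrite quadZ mulr_ge0.
Qed.

Lemma psd0 n : psd (0 : 'M[R]_n).
Proof. by split=> [|v]; rewrite ?trmx0 ?quad0. Qed.

Lemma psd1 n : psd (1%:M : 'M[R]_n).
Proof. by split=> [|v]; rewrite ?trmx1 // quad1 sqnorm_ge0. Qed.

Lemma psd_sum n I (r : seq I) (P : pred I) (F : I -> 'M[R]_n) :
  (forall i, P i -> psd (F i)) -> psd (\sum_(i <- r | P i) F i).
Proof. by move=> h; apply: big_ind => //; [exact: psd0 | exact: psdD]. Qed.

Lemma psd_congr m n (M : 'M[R]_m) (A : 'M[R]_(m, n)) :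
  psd M -> psd (A^T *m M *m A).
Proof.
move=> [sM pM]; split; first by rewrite !trmx_mul trmxK sM mulmxA.
by move=> v; rewrite quad_congr.
Qed.

Lemma posdefD n (M N : 'M[R]_n) : posdef M -> psd N -> posdef (M + N).
Proof.
move=> [sM pM] [sN pN]; split; first by rewrite linearD /= sM sN.
by move=> v v0; rewrite quadD ltr_pwDl ?pM.
Qed.

(** Subtracting the rank one matrix s s^T / S_aa, where s is column a of S,
    keeps S positive semidefinite and clears row a; clearing the rows one
    after the other writes S as a sum of matrices s s^T with s a column, and
    tr (s s^T Y) = quad Y s. *)
Lemma psd_trM_ge0 n (S Y : 'M[R]_n) : psd S -> (forall v, 0 <= quad Y v) ->
  0 <= \tr (S *m Y).
Proof.
move=> + pY; have [m] := ubnP #|[pred a | row a S != 0]|.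
elim: m S => // m IH S; rewrite ltnS => hm pS.
have [/existsP[a ha]|] := boolP [exists a, row a S != 0]; last first.
  rewrite negb_exists => /forallP h.
  have -> : S = 0; last by rewrite mul0mx mxtrace0.
  by apply/row_matrixP => a; rewrite row0; apply/eqP; have := h a; rewrite negbK.
have [sS qS] := pS.
have Saa : 0 < S a a.
  rewrite lt0r -bform_delta -quadE qS andbT quadE bform_delta.
  apply: contra ha => /eqP h; apply/eqP/rowP => j.
  by rewrite !mxE psd_row0.
pose s := S *m delta_mx a (0 : 'I_1).
have ses : s = col a S by rewrite /s -colE.
have eqs v : quad (s *m s^T) v = bform S (delta_mx a 0) v ^+ 2.
  have -> : bform S (delta_mx a 0) v = (s^T *m v) 0 0.
    by rewrite /bform /s trmx_mul sS.
  by have := quad_gram s^T v; rewrite trmxK => ->; rewrite /sqnorm big_ord1.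
pose S' := S - (S a a)^-1 *: (s *m s^T).
have pS' : psd S'.
  split; first by rewrite linearB linearZ /= trmx_mul trmxK sS.
  move=> v; rewrite quadB quadZ eqs subr_ge0 mulrC ler_pdivrMr // mulrC.
  have := psd_bform_le (delta_mx a 0) v pS.
  by rewrite quadE bform_delta mulrC.
have hrow b : row b S = 0 -> row b S' = 0.
  move=> hb; rewrite /S' linearB linearZ /= row_mul hb sub0r.
  by rewrite /s row_mul hb mul0mx mul0mx scaler0 oppr0.
have hrowa : row a S' = 0.
  apply/rowP => j.
  have -> : row a S' 0 j = S a j - (S a a)^-1 * (S a a * S j a).
    by rewrite !mxE big_ord1 ses !mxE.
  have -> : S j a = S a j by rewrite -{1}sS mxE.
  by rewrite mulrA mulVf ?gt_eqF // mul1r subrr mxE.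
have IH' : 0 <= \tr (S' *m Y).
  apply: IH pS'; apply: leq_trans hm; apply: proper_card.
  apply/properP; split.
    by apply/fintype.subsetP => b; rewrite !inE; apply: contra => /eqP /hrow ->.
  by exists a; rewrite !inE // hrowa eqxx.
have -> : S = S' + (S a a)^-1 *: (s *m s^T) by rewrite subrK.
rewrite mulmxDl mxtraceD addr_ge0 // -scalemxAl mxtraceZ mulr_ge0 //.
  by rewrite invr_ge0 ltW.
by rewrite mxtrace_mulC -quad_tr.
Qed.

End spectrum.

Section singular.
Variable R : realType.

Lemma eigenvalue_col n (M : 'M[R]_n) a (v : 'cV_n) :
  M^T = M -> v != 0 -> M *m v = a *: v -> eigenvalue M a.
Proof.
move=> sM v0 h; apply/eigenvalueP; exists v^T; last by rewrite trmx_eq0.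
by rewrite -{1}sM -trmx_mul h linearZ.
Qed.

Lemma gram_sym m n (M : 'M[R]_(m, n)) : (M^T *m M)^T = M^T *m M.
Proof. by rewrite trmx_mul trmxK. Qed.

Lemma singular_vector m n (M : 'M[R]_(m, n)) s : singular_values M s ->
  exists2 v : 'cV_n, v != 0 & sqnorm (M *m v) = s ^+ 2 * sqnorm v.
Proof.
move=> [s0 /(sym_eigenvector (gram_sym M))[v v0 h]]; exists v => //.
by rewrite -quad_gram /quad -mulmxA h -scalemxAr mxE -quad1 /quad mulmx1.
Qed.

Lemma singular_ubound m n (M : 'M[R]_(m, n)) : has_ubound (singular_values M).
Proof.
exists (2 * l1 (M^T *m M) + 1) => s hs.
have [v v0 h] := singular_vector hs.
have := quad_le (M^T *m M) v; rewrite quad_gram h ler_pM2r ?sqnorm_gt0 // => h2.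
have s2 : 0 <= (s - 1) ^+ 2 := sqr_ge0 _.
have s3 := hs.1; have s4 := sqr_ge0 s.
rewrite sqrrB in s2; lra.
Qed.

Lemma spectral_norm_ge0 m n (M : 'M[R]_(m, n)) : 0 <= spectral_norm M.
Proof.
have [h|/set0P[s hs]] := eqVneq (singular_values M) set0.
  by rewrite /spectral_norm h sup0.
exact: le_trans hs.1 (ub_le_sup (singular_ubound M) hs).
Qed.

(** The largest eigenvalue of M^T M is the square of a singular value. *)
Lemma spectral_normP m n (M : 'M[R]_(m, n)) v : (0 < n)%N ->
  sqnorm (M *m v) <= spectral_norm M ^+ 2 * sqnorm v.
Proof.
move=> n0; have [lam h1 h2] := sym_max_eigenvalue n0 (gram_sym M).
have l0 : 0 <= lam.
  have [u u0 h] := sym_eigenvector (gram_sym M) h1.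
  have : 0 <= quad (M^T *m M) u by rewrite quad_gram sqnorm_ge0.
  rewrite /quad -mulmxA h -scalemxAr mxE -[u^T]mulmx1 -/(quad _ _) quad1.
  by rewrite pmulr_lge0 ?sqnorm_gt0.
rewrite -quad_gram; apply: le_trans (h2 v) _; rewrite ler_wpM2r ?sqnorm_ge0 //.
rewrite -[lam]sqr_sqrtr // lerXn2r ?nnegrE ?sqrtr_ge0 ?spectral_norm_ge0 //.
apply: (ub_le_sup (singular_ubound M)); split; first exact: sqrtr_ge0.
by rewrite sqr_sqrtr.
Qed.

(** The largest eigenvalue lam of M is a singular value: M^T M multiplies an
    eigenvector of M by lam^2. *)
Lemma psd_le_spectral_norm n (M : 'M[R]_n) v : (0 < n)%N -> psd M ->
  quad M v <= spectral_norm M * sqnorm v.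
Proof.
move=> n0 [sM pM]; have [lam h1 h2] := sym_max_eigenvalue n0 sM.
have [u u0 h] := sym_eigenvector sM h1.
have l0 : 0 <= lam.
  have := pM u; rewrite /quad -mulmxA h -scalemxAr mxE.
  by rewrite -[u^T]mulmx1 -/(quad _ _) quad1 pmulr_lge0 ?sqnorm_gt0.
apply: le_trans (h2 v) _; rewrite ler_wpM2r ?sqnorm_ge0 //.
apply: (ub_le_sup (singular_ubound M)); split=> //.
apply: eigenvalue_col (gram_sym M) u0 _.
by rewrite sM -mulmxA h -scalemxAr h scalerA expr2.
Qed.

(** For a positive definite matrix the least singular value is the least
    eigenvalue: if |M v| = s |v|, then lam |v|^2 <= v^T M v forces lam <= s. *)
Lemma posdef_sigma_min n (M : 'M[R]_n) : (0 < n)%N -> posdef M ->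
  0 < sigma_min M /\ forall v, sigma_min M * sqnorm v <= quad M v.
Proof.
move=> n0 pM; have [sM hM] := pM.
have [lam h1 h2] := sym_min_eigenvalue n0 sM.
have [u u0 h] := sym_eigenvector sM h1.
have l0 : 0 < lam.
  have := hM u u0; rewrite /quad -mulmxA h -scalemxAr mxE.
  by rewrite -[u^T]mulmx1 -/(quad _ _) quad1 pmulr_lgt0 ?sqnorm_gt0.
have lS : singular_values M lam.
  split; first exact: ltW.
  apply: eigenvalue_col (gram_sym M) u0 _.
  by rewrite sM -mulmxA h -scalemxAr h scalerA expr2.
have hlb : lbound (singular_values M) lam.
  move=> s hs; have [v v0 hv] := singular_vector hs.
  have v1 := sqnorm_gt0 v0; have s0 := hs.1.
  have := psd_bform_le (M *m v) v (psd1 R n).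
  rewrite {1}/bform mulmx1 trmx_mul sM -/(quad _ _) !quad1 hv => hq.
  have hl := h2 v.
  have : (lam * sqnorm v) ^+ 2 <= (s * sqnorm v) ^+ 2.
    apply: (@le_trans _ _ (quad M v ^+ 2)).
      rewrite lerXn2r ?nnegrE // ?mulr_ge0 ?ltW //.
      by apply: lt_le_trans hl; rewrite mulr_gt0.
    by apply: le_trans hq _; rewrite exprMn -mulrA expr2 -expr2.
  by rewrite ler_pXn2r ?nnegrE ?mulr_ge0 ?(ltW l0) ?(ltW v1) // ler_pM2r.
have bS : has_lbound (singular_values M) by exists lam.
have -> : sigma_min M = lam.
  apply/eqP; rewrite eq_le; apply/andP; split; first exact: ge_inf.
  by apply: lb_le_inf hlb; exists lam.
by [].
Qed.

End singular.

Section blocks.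
Variable R : realType.

Lemma quad_mxdiag ns d (S : 'I_ns -> 'M[R]_d) (V : 'I_ns -> 'cV[R]_d) :
  quad (\mxdiag_(i < ns) S i) (\mxcol_(i < ns) V i) = \sum_i quad (S i) (V i).
Proof.
rewrite /quad -mulmxA mul_mxdiag_mxcol tr_mxcol mul_mxrow_mxcol summxE.
by apply: eq_bigr => i _; rewrite mulmxA.
Qed.

Lemma sqnorm_mxcol ns d (V : 'I_ns -> 'cV[R]_d) :
  sqnorm (\mxcol_(i < ns) V i) = \sum_i sqnorm (V i).
Proof.
rewrite -quad1 /quad mulmx1 tr_mxcol mul_mxrow_mxcol summxE.
by apply: eq_bigr => i _; rewrite -quad1 /quad mulmx1.
Qed.

Definition embed ns d (i : 'I_ns) (u : 'cV[R]_d) : 'cV[R]_(\sum_(j < ns) d) :=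
  \mxcol_(j < ns) (if j == i then u else 0).

Lemma sqnorm_embed ns d (i : 'I_ns) (u : 'cV[R]_d) :
  sqnorm (embed i u) = sqnorm u.
Proof.
rewrite sqnorm_mxcol (bigD1 i) //= eqxx big1 ?addr0 // => j /negPf ->.
by rewrite -quad1 /quad mulmx0 mxE.
Qed.

Lemma quad_mxdiag_embed ns d (S : 'I_ns -> 'M[R]_d) i (u : 'cV[R]_d) :
  quad (\mxdiag_(i < ns) S i) (embed i u) = quad (S i) u.
Proof.
rewrite quad_mxdiag (bigD1 i) //= eqxx big1 ?addr0 // => j /negPf ->.
by rewrite /quad mulmx0 mxE.
Qed.

Lemma psd_mxdiag ns d (S : 'I_ns -> 'M[R]_d) :
  (forall i, psd (S i)) -> psd (\mxdiag_(i < ns) S i).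
Proof.
move=> pS; split.
  by rewrite tr_mxdiag; apply: eq_mxdiag => i; case: (pS i).
move=> v; rewrite -(submxcolK v) quad_mxdiag sumr_ge0 // => i _.
by case: (pS i).
Qed.

Lemma posdef_mxdiag ns d (S : 'I_ns -> 'M[R]_d) :
  (forall i, posdef (S i)) -> posdef (\mxdiag_(i < ns) S i).
Proof.
move=> pS; have [sD pD] := psd_mxdiag (fun i => posdef_psd (pS i)).
split=> // v; rewrite -(submxcolK v) => v0; rewrite lt0r pD andbT.
rewrite quad_mxdiag psumr_eq0 => [|i _]; last by case: (posdef_psd (pS i)).
apply: contra v0 => /allP h; apply/eqP/mxcolP => i.
rewrite submxcol0 mxcolK; apply/eqP.
have := h i (mem_index_enum i); rewrite /= => /eqP q0.
by apply: contraT => vi; have := (pS i).2 _ vi; rewrite q0 ltxx.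
Qed.

Lemma block_diag_embed ns d k (B : 'I_ns -> 'M[R]_(d, k)) i (u : 'cV[R]_k) :
  (\mxblock_(i < ns, j < ns) (if i == j then B i else 0)) *m embed i u
    = embed i (B i *m u).
Proof.
rewrite mxblockEv mxcol_mul; apply: eq_mxcol => l.
rewrite mul_mxrow_mxcol (bigD1 i) //= eqxx big1 => [|j /negPf ->].
  by rewrite addr0; case: eqP => [->|]; rewrite ?mul0mx.
by rewrite mulmx0.
Qed.

End blocks.

(** * Lyapunov operators of a jump system *)

Section matrix_limits.
Variable R : realType.

Lemma cvg_mx m n (f : nat -> 'M[R]_(m, n)) (M : 'M[R]_(m, n)) :
  (forall i j, f t i j @[t --> \oo] --> M i j) -> f t @[t --> \oo] --> M.
Proof.
move=> h; apply/cvgrPdist_lt => e e0.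
have hh : \forall t \near \oo, forall i j, `|M i j - f t i j| < e.
  apply: filter_forall => i; apply: filter_forall => j.
  by have /cvgrPdist_lt /(_ e e0) := h i j.
apply: filterS hh => t ht.
rewrite [ltLHS]mx_normrE; apply/bigmax_ltP; split=> // -[i j] _ /=.
by rewrite !mxE; exact: ht.
Qed.

Lemma cvg_to_eq (f : nat -> R) (l l' : R) :
  f t @[t --> \oo] --> l -> l = l' -> f t @[t --> \oo] --> l'.
Proof. by move=> + <-. Qed.

Lemma cvg_sumr I (r : seq I) (Q : pred I) (f : I -> nat -> R) (l : I -> R) :
  (forall i, f i t @[t --> \oo] --> l i) ->
  \sum_(i <- r | Q i) f i t @[t --> \oo] --> \sum_(i <- r | Q i) l i.
Proof. by move=> h; apply: cvg_big => //; exact: add_continuous. Qed.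

Lemma cvg_sumr0 I (r : seq I) (Q : pred I) (f : I -> nat -> R) :
  (forall i, f i t @[t --> \oo] --> (0 : R)) ->
  \sum_(i <- r | Q i) f i t @[t --> \oo] --> (0 : R).
Proof.
by move=> h; apply: cvg_to_eq (cvg_sumr h) _; exact: big1.
Qed.

Lemma cvg_bform n (f : nat -> 'M[R]_n) (M : 'M[R]_n) u v :
  (forall i j, f t i j @[t --> \oo] --> M i j) ->
  bform (f t) u v @[t --> \oo] --> bform M u v.
Proof.
move=> h; rewrite bformE; under eq_cvg do rewrite bformE.
apply: cvg_sumr => i; apply: cvg_sumr => j.
by apply: cvgMr_tmp; apply: cvgMl_tmp; exact: h.
Qed.

Lemma limit_ge0 (f : nat -> R) (l : R) :
  (forall t, 0 <= f t) -> f t @[t --> \oo] --> l -> 0 <= l.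
Proof. by move=> h fl; apply: (cvgr_to_ge fl); exact: nearW. Qed.

Lemma bounded_series_cvg0 (f : nat -> R) (c : R) : (forall t, 0 <= f t) ->
  (forall t, \sum_(0 <= s < t) f s <= c) -> f t @[t --> \oo] --> 0.
Proof.
move=> f0 fc; apply: cvg_series_cvg_0; apply: nondecreasing_is_cvgn.
  by apply/nondecreasing_seqP => n; rewrite /series /= big_nat_recr //= lerDl.
by exists c => _ [n _ <-]; exact: fc.
Qed.

End matrix_limits.

Section operator.
Variables (R : realType) (d ns : nat).
Local Notation family := ('I_ns -> 'M[R]_d).
Variable op : family -> family.
Hypothesis op_linear : forall a X Y,
  op (fun i => a *: X i + Y i) = (fun i => a *: op X i + op Y i).
Hypothesis op_vanish : forall X i a b, iter t op X i a b @[t --> \oo] --> 0.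

Lemma op0 : op (fun=> 0) = (fun=> 0).
Proof.
have h := op_linear (-1) (fun=> 0) (fun=> 0); apply/funext => i.
have {h} := congr1 (fun f => f i) h; rewrite /=.
rewrite (_ : (fun _ : 'I_ns => _) = (fun=> 0)); last first.
  by apply/funext => j; rewrite scaler0 addr0.
by rewrite scaleN1r addNr.
Qed.

Lemma opD X Y : op (fun i => X i + Y i) = (fun i => op X i + op Y i).
Proof.
have := op_linear 1 X Y.
rewrite (_ : (fun i => 1 *: X i + Y i) = (fun i => X i + Y i)); last first.
  by apply/funext => j; rewrite scale1r.
by move=> ->; apply/funext => j; rewrite scale1r.
Qed.

Lemma opZ a X : op (fun i => a *: X i) = (fun i => a *: op X i).
Proof.
have := op_linear a X (fun=> 0); rewrite op0.
rewrite (_ : (fun i => a *: X i + 0) = (fun i => a *: X i)); last first.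
  by apply/funext => j; rewrite addr0.
by move=> ->; apply/funext => j; rewrite addr0.
Qed.

Lemma opB X Y : op (fun i => X i - Y i) = (fun i => op X i - op Y i).
Proof.
have := op_linear (-1) Y X.
rewrite (_ : (fun i => -1 *: Y i + X i) = (fun i => X i - Y i)); last first.
  by apply/funext => j; rewrite scaleN1r addrC.
by move=> ->; apply/funext => j; rewrite scaleN1r addrC.
Qed.

Lemma fixpoint_eq0 X : X = op X -> X = (fun=> 0).
Proof.
move=> h; have hi t : iter t op X = X by elim: t => //= t ->.
apply/funext => i; apply/matrixP => a b; rewrite mxE.
have := @op_vanish X i a b; under eq_cvg do rewrite hi.
by move/(cvg_unique _ (cvg_cst _)) => ->.
Qed.

Lemma affine_fixpoint_unique F X Y :
  (forall i, X i = F i + op X i) -> (forall i, Y i = F i + op Y i) -> X = Y.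
Proof.
move=> hX hY; have : (fun i => X i - Y i) = (fun=> 0).
  apply: fixpoint_eq0; rewrite opB; apply/funext => i.
  by rewrite {1}hX {1}hY opprD addrACA subrr add0r.
move=> h; apply/funext => i; apply/eqP; rewrite -subr_eq0; apply/eqP.
exact: (congr1 (fun f => f i) h).
Qed.

(** In finite dimension the linear map id - op is onto as soon as it is
    one-to-one. *)
Lemma affine_fixpoint_exists F : exists X, forall i, X i = F i + op X i.
Proof.
pose U := {ffun 'I_ns -> 'M[R]_d}.
pose g (X : U) : U := [ffun i => X i - op X i].
have gl : linear g.
  move=> a X Y; apply/ffunP => i.
  transitivity ((a *: X + Y) i - op (fun i => a *: X i + Y i) i).
    rewrite ffunE; congr (_ - op _ _); apply/funext => j.
    by rewrite !ffunE.
  by rewrite op_linear !ffunE scalerBr opprD addrACA.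
pose gL : {linear U -> U} := HB.pack g (GRing.isLinear.Build R U U _ g gl).
have gK : lker (linfun gL) == 0%VS.
  apply/lker0P => X Y; rewrite !lfunE /= => /ffunP h.
  have e : (X : family) = Y.
    apply: (@affine_fixpoint_unique (g X)) => i.
      by rewrite ffunE subrK.
    by rewrite /g h ffunE subrK.
  by apply/ffunP => i; rewrite e.
pose X := ((linfun gL)^-1)%VF [ffun i => F i].
exists X => i.
have /ffunP /(_ i) : g X = [ffun i => F i].
  by rewrite -[g X]/(gL X) -(lfunE gL) lker0_lfunVK.
by rewrite !ffunE => <-; rewrite subrK.
Qed.

Hypothesis op_psd : forall X, (forall i, psd (X i)) -> forall i, psd (op X i).

Lemma remainderS F X t : (forall i, X i = F i + op X i) ->
  forall i, X i - iter t.+1 op X i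
    = F i + op (fun i => X i - iter t op X i) i.
Proof. by move=> h i; rewrite opB iterS {1}h addrA. Qed.

Lemma op_sum (r : seq nat) (Y : nat -> family) i :
  op (fun i => \sum_(s <- r) Y s i) i = \sum_(s <- r) op (Y s) i.
Proof.
elim: r i => [|s r IH] i.
  rewrite big_nil (_ : (fun _ : 'I_ns => _) = (fun=> 0)) ?op0 //.
  by apply/funext => j; rewrite big_nil.
rewrite big_cons -IH.
rewrite -[_ + _]/((fun i => op (Y s) i + op (fun i => \sum_(s <- r) Y s i) i) i).
rewrite -opD; congr (op _ i); apply/funext => j; exact: big_cons.
Qed.

Lemma sum_iter F X t : (forall i, X i = F i + op X i) ->
  forall i, \sum_(0 <= s < t) iter s op F i = X i - iter t op X i.
Proof.
move=> h; elim: t => [|t IH] i; first by rewrite big_geq // subrr.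
rewrite (remainderS t h) big_nat_recl //=; congr (_ + _).
have -> : (fun i => X i - iter t op X i)
    = (fun i => \sum_(0 <= s < t) iter s op F i) by apply/funext.
by rewrite op_sum.
Qed.

Lemma remainder_cvg X i a b :
  (X i - iter t op X i) a b @[t --> \oo] --> X i a b.
Proof.
under eq_cvg do rewrite !mxE.
apply: (@cvg_to_eq R _ (X i a b - 0)); last exact: subr0.
by apply: cvgB; [exact: cvg_cst | exact: op_vanish].
Qed.

(** X is the limit of X - op^t X, which is the sum of the first t iterates of
    F and therefore positive semidefinite. *)
Lemma fixpoint_psd F X : (forall i, psd (F i)) ->
  (forall i, X i = F i + op X i) -> forall i, psd (X i).
Proof.
move=> pF h; have pW t i : psd (X i - iter t op X i).
  elim: t i => [|t IH] i; first by rewrite subrr; exact: psd0.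
  by rewrite (remainderS t h); apply: psdD; [exact: pF | exact: op_psd].
move=> i; split.
  apply/matrixP => a b; rewrite mxE.
  have h1 := @remainder_cvg X i a b; have := @remainder_cvg X i b a.
  rewrite (_ : (fun t => (X i - iter t op X i) b a)
             = (fun t => (X i - iter t op X i) a b)).
    by move=> h2; exact: (cvg_unique _ h2 h1).
  by apply/funext => t; have [e _] := pW t i; rewrite -{1}e mxE.
move=> v; apply: (@limit_ge0 R (fun t => quad (X i - iter t op X i) v)).
  by move=> t; case: (pW t i).
by apply: cvg_bform => a b; exact: remainder_cvg.
Qed.

End operator.

Lemma tr_delta_mul (R : realType) m n (M : 'M[R]_(m, n)) a b :
  \tr (delta_mx b a *m M) = M a b.
Proof.
rewrite mxtrace_mulC /mxtrace (bigD1 a) //= mxE (bigD1 b) //= mxE !eqxx mulr1.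
rewrite !big1 ?addr0 // => [l la|l lb].
  by rewrite mxE big1 // => q _; rewrite mxE (negPf la) andbF mulr0.
by rewrite mxE (negPf lb) mulr0.
Qed.

Section jump.
Variables (R : realType) (d ns : nat) (p : 'I_ns -> 'I_ns -> R).
Variable A : 'I_ns -> 'M[R]_d.
Local Notation family := ('I_ns -> 'M[R]_d).
Implicit Types (F X Y : family).

(** The conditional expectation of the family at the next mode. *)
Definition expect F : family := fun i => \sum_j p i j *: F j.

(** The Lyapunov operator of the jump system; fwd is its adjoint for pairing
    and propagates the second moments of the state, mode by mode. *)
Definition back F : family := fun i => (A i)^T *m expect F i *m A i.

Definition fwd X : family := fun j => \sum_i p i j *: (A i *m X i *m (A i)^T).

Definition pairing F X : R := \sum_i \tr (F i *m X i).

(** The quadratic form is the mean square of the state at time t, started in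
    mode i at the point v. *)
Definition stable : Prop := forall i v,
  quad (iter t back (fun=> 1%:M) i) v @[t --> \oo] --> 0.

Lemma bform_back F i u v :
  bform (back F i) u v = \sum_j p i j * bform (F j) (A i *m u) (A i *m v).
Proof.
by rewrite bform_congr bform_sum; apply: eq_bigr => j _; rewrite bformZ.
Qed.

Lemma quad_back F i v :
  quad (back F i) v = \sum_j p i j * quad (F j) (A i *m v).
Proof. exact: bform_back. Qed.

Lemma expect_linear a X Y :
  expect (fun i => a *: X i + Y i) = (fun i => a *: expect X i + expect Y i).
Proof.
apply/funext => i; rewrite /expect scaler_sumr -big_split; apply: eq_bigr => j _.
by rewrite /= scalerDr !scalerA mulrC.
Qed.

Lemma back_linear a X Y :
  back (fun i => a *: X i + Y i) = (fun i => a *: back X i + back Y i).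
Proof.
apply/funext => i; rewrite /back expect_linear.
by rewrite mulmxDr mulmxDl -scalemxAr -scalemxAl.
Qed.

Lemma fwd_linear a X Y :
  fwd (fun i => a *: X i + Y i) = (fun i => a *: fwd X i + fwd Y i).
Proof.
apply/funext => j; rewrite /fwd scaler_sumr -big_split; apply: eq_bigr => i _.
rewrite /= mulmxDr mulmxDl -scalemxAr -scalemxAl scalerDr !scalerA.
by rewrite [p i j * a]mulrC.
Qed.

Lemma pairing_back F X : pairing (back F) X = pairing F (fwd X).
Proof.
rewrite /pairing.
transitivity (\sum_i \sum_j \tr (p i j *: (F j *m (A i *m X i *m (A i)^T)))).
  apply: eq_bigr => i _; rewrite /back /expect.
  rewrite mulmx_sumr !mulmx_suml raddf_sum; apply: eq_bigr => j _ /=.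
  rewrite -!scalemxAr -!scalemxAl !mxtraceZ; congr (_ * _).
  by rewrite -!mulmxA mxtrace_mulC !mulmxA.
rewrite exchange_big; apply: eq_bigr => j _.
rewrite mulmx_sumr raddf_sum; apply: eq_bigr => i _ /=.
by rewrite -scalemxAr.
Qed.

Lemma pairing_iter_back F X t :
  pairing (iter t back F) X = pairing F (iter t fwd X).
Proof. by elim: t F => // t IH F; rewrite iterSr IH pairing_back. Qed.

Lemma pairing_delta X i a b :
  pairing (fun j => if j == i then delta_mx b a else 0) X = X i a b.
Proof.
rewrite /pairing (bigD1 i) //= eqxx [X in _ + X]big1 ?addr0; last first.
  by move=> j /negPf ->; rewrite mul0mx mxtrace0.
exact: tr_delta_mul.
Qed.

Hypothesis p_ge0 : forall i j, 0 <= p i j.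

Lemma expect_psd F : (forall i, psd (F i)) -> forall i, psd (expect F i).
Proof. by move=> pF i; apply: psd_sum => j _; apply: psdZ. Qed.

Lemma back_psd F : (forall i, psd (F i)) -> forall i, psd (back F i).
Proof. by move=> pF i; apply/psd_congr/expect_psd. Qed.

Lemma fwd_psd X : (forall i, psd (X i)) -> forall i, psd (fwd X i).
Proof.
move=> pX j; apply: psd_sum => i _; apply: psdZ => //.
by rewrite -{1}(trmxK (A i)); exact: psd_congr.
Qed.

Lemma iter_back_psd F t : (forall i, psd (F i)) ->
  forall i, psd (iter t back F i).
Proof. by move=> pF; elim: t => // t IH; exact: back_psd. Qed.

Lemma mean_square_ge0 t i v : 0 <= quad (iter t back (fun=> 1%:M) i) v.
Proof. by have [_ ->] := iter_back_psd t (fun=> psd1 R d) i. Qed.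

(** back averages bilinear forms with nonnegative weights after a common
    substitution, which preserves a bound of |F(u, v)| by c (M(u) + M(v)). *)
Lemma iter_back_dominated F c t : 0 <= c -> (forall i, 2 * l1 (F i) <= c) ->
  forall i u v, `|bform (iter t back F i) u v|
    <= c * (quad (iter t back (fun=> 1%:M) i) u
            + quad (iter t back (fun=> 1%:M) i) v).
Proof.
move=> c0 hc; elim: t => [|t IH] i u v.
  rewrite /= !quad1; apply: le_trans (norm_bform_le _ _ _) _.
  rewrite ler_wpM2r ?addr_ge0 ?sqnorm_ge0 //; have := hc i.
  by have := l1_ge0 (F i); lra.
rewrite !iterS bform_back !quad_back -big_split mulr_sumr.
apply: le_trans (ler_norm_sum _ _ _) _; apply: ler_sum => j _ /=.
rewrite normrM ger0_norm // -mulrDr mulrCA ler_wpM2l //; exact: IH.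
Qed.

Lemma back_vanish F i a b : stable ->
  iter t back F i a b @[t --> \oo] --> 0.
Proof.
move=> hs; pose c := \sum_i 2 * l1 (F i).
have c0 : 0 <= c by apply: sumr_ge0 => j _; rewrite mulr_ge0 ?l1_ge0.
have hc j : 2 * l1 (F j) <= c.
  by rewrite /c (bigD1 j) //= lerDl sumr_ge0 // => k _; rewrite mulr_ge0 ?l1_ge0.
apply/cvgr0Pnorm_le => e e0.
have h : c * (quad (iter t back (fun=> 1%:M) i) (delta_mx a 0)
            + quad (iter t back (fun=> 1%:M) i) (delta_mx b 0))
   @[t --> \oo] --> 0.
  apply: (@cvg_to_eq R _ (c * (0 + 0))); last by rewrite addr0 mulr0.
  by apply: cvgMl_tmp; apply: cvgD; exact: hs.
have /cvgr0Pnorm_le /(_ e e0) := h; apply: filterS => t.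
apply: le_trans; rewrite -bform_delta.
apply: le_trans (iter_back_dominated t c0 hc _ _ _) _.
exact: ler_norm.
Qed.

Lemma fwd_vanish X i a b : stable ->
  iter t fwd X i a b @[t --> \oo] --> 0.
Proof.
move=> hs; under eq_cvg do rewrite -pairing_delta -pairing_iter_back.
apply: cvg_sumr0 => j; apply: cvg_sumr0 => k; under eq_cvg do rewrite mxE.
apply: cvg_sumr0 => l; apply: (@cvg_to_eq R _ (0 * X j l k)); last exact: mul0r.
by apply: cvgMr_tmp; exact: back_vanish.
Qed.

(** Summing the decrease along a trajectory bounds the series of the mean
    squares, whose terms therefore tend to 0. *)
Lemma lyapunov_stable Y e : 0 < e -> (forall i, psd (Y i)) ->
  (forall i v, quad (back Y i) v <= quad (Y i) v - e * sqnorm v) -> stable.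
Proof.
move=> e0 pY hY i v.
have h t : forall i v,
    e * \sum_(0 <= s < t) quad (iter s back (fun=> 1%:M) i) v <= quad (Y i) v.
  elim: t => [|t IH] {}i {}v; first by rewrite big_geq // mulr0; case: (pY i).
  rewrite big_nat_recl //= quad1 mulrDr.
  apply: le_trans (_ : e * sqnorm v + quad (back Y i) v <= _); last first.
    by have := hY i v; lra.
  rewrite lerD2l quad_back.
  under eq_bigr do rewrite quad_back.
  rewrite exchange_big mulr_sumr; apply: ler_sum => j _.
  by rewrite -mulr_sumr mulrCA ler_wpM2l.
apply: (@bounded_series_cvg0 R _ (e^-1 * quad (Y i) v)).
  by move=> t; exact: mean_square_ge0.
by move=> t; rewrite ler_pdivlMl.
Qed.

Lemma back_sym F : (forall i, (F i)^T = F i) -> forall i, (back F i)^T = back F i.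
Proof.
move=> sF i; rewrite /back !trmx_mul trmxK -mulmxA; congr (_ *m (_ *m _)).
rewrite /expect linear_sum; apply: eq_bigr => j _ /=.
by rewrite linearZ /= sF.
Qed.

(** Each of t W + D and t W - D exceeds its image under back by a positive
    semidefinite family, and is therefore positive semidefinite. *)
Lemma comparison W D t : stable -> (forall i, (W i)^T = W i) ->
  (forall i, (D i)^T = D i) ->
  (forall i v, `|quad (D i - back D i) v| <= t * quad (W i - back W i) v) ->
  forall i v, `|quad (D i) v| <= t * quad (W i) v.
Proof.
move=> hs sW sD hWD.
have key s : `|s| <= 1 -> forall i, psd (t *: W i + s *: D i).
  move=> s1; apply: (@fixpoint_psd _ _ _ back back_linear _ back_psd
    (fun i => t *: (W i - back W i) + s *: (D i - back D i))).
  - by move=> X i a b; exact: back_vanish.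
  - move=> i; split; first by
      rewrite linearD /= !linearZ /= !linearB /= sW sD (back_sym sW) (back_sym sD).
    move=> v; rewrite quadD !quadZ -[X in 0 <= _ + X]opprK subr_ge0.
    apply: le_trans (hWD i v); apply: le_trans (ler_norm _) _.
    by rewrite normrN normrM ler_piMl.
  - move=> i; rewrite back_linear (opZ back_linear) !scalerBr.
    by rewrite [X in _ = X + _]addrACA -opprD subrK.
move=> i v; have kp := (key 1 _ i).2 v; have km := (key (-1) _ i).2 v.
rewrite !quadD !quadZ mul1r mulN1r in kp km.
rewrite ler_norml -subr_ge0 opprK addrC kp ?normr1 //=.
by rewrite -subr_ge0 km // normrN1.
Qed.

Lemma pairing_ge0 F X : (forall i v, 0 <= quad (F i) v) ->
  (forall i, psd (X i)) -> 0 <= pairing F X.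
Proof.
move=> pF pX; apply: sumr_ge0 => i _.
by rewrite mxtrace_mulC; exact: psd_trM_ge0.
Qed.

Lemma pairingZ a F X : pairing (fun i => a *: F i) X = a * pairing F X.
Proof.
rewrite /pairing mulr_sumr; apply: eq_bigr => i _.
by rewrite -scalemxAl mxtraceZ.
Qed.

Lemma pairingB F Y X :
  pairing (fun i => F i - Y i) X = pairing F X - pairing Y X.
Proof.
rewrite /pairing -sumrB; apply: eq_bigr => i _.
by rewrite mulmxBl linearB.
Qed.

Lemma pairingBr F X Y :
  pairing F (fun i => X i - Y i) = pairing F X - pairing F Y.
Proof.
rewrite /pairing -sumrB; apply: eq_bigr => i _.
by rewrite mulmxBr linearB.
Qed.

Lemma pairing_ler F Y X : (forall i v, quad (F i) v <= quad (Y i) v) ->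
  (forall i, psd (X i)) -> pairing F X <= pairing Y X.
Proof.
move=> h pX; rewrite -subr_ge0 -pairingB pairing_ge0 // => i v.
by rewrite quadB subr_ge0.
Qed.

End jump.

(** * Means and independence *)

Section means.
Context (R : realType) (disp : measure_display) (T : measurableType disp).
Variable P : probability T R.
Implicit Types (f g : T -> R).

Definition has_mean f (v : R) : Prop :=
  P.-integrable setT (EFin \o f) /\ (\int[P]_s (f s)%:E)%E = v%:E.

Lemma mean_eq f g v : f =1 g -> has_mean f v -> has_mean g v.
Proof. by move=> /funext <-. Qed.

Lemma mean_expectation f v : has_mean f v -> ('E_P[f])%E = v%:E.
Proof. by rewrite unlock => -[]. Qed.

Lemma mean_measurable f v : has_mean f v -> measurable_fun setT f.
Proof. by move=> [/integrableP[/measurable_EFinP]]. Qed.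

Lemma meanD f g u v : has_mean f u -> has_mean g v ->
  has_mean (fun s => f s + g s) (u + v).
Proof.
move=> [fi fu] [gi gv]; split; first exact: (integrableD _ fi gi).
rewrite EFinD -fu -gv -integralD //.
Qed.

Lemma meanZ a f u : has_mean f u -> has_mean (fun s => a * f s) (a * u).
Proof.
move=> [fi fu]; split; first exact: (integrableZl _ _ fi).
by rewrite EFinM -fu -integralZl.
Qed.

Lemma mean0 : has_mean (fun=> 0) 0.
Proof. by split; [exact: integrable0 | exact: integral0]. Qed.

Lemma mean_sum I (r : seq I) (F : I -> T -> R) (v : I -> R) :
  (forall i, has_mean (F i) (v i)) ->
  has_mean (fun s => \sum_(i <- r) F i s) (\sum_(i <- r) v i).
Proof.
move=> h; elim: r => [|i r IH].
  rewrite big_nil; apply: mean_eq mean0 => s; by rewrite big_nil.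
rewrite big_cons; apply: mean_eq (meanD (h i) IH) => s; by rewrite big_cons.
Qed.

Lemma mean_unique f u v : has_mean f u -> has_mean f v -> u = v.
Proof. by move=> [_ fu] [_]; rewrite fu => -[]. Qed.

Lemma prob_fineK F : measurable F -> P F = (fine (P F))%:E.
Proof. by move=> mF; rewrite fineK // fin_num_measure. Qed.

Lemma mean_indic F : measurable F -> has_mean \1_F (fine (P F)).
Proof.
move=> mF; split; last by rewrite integral_indic // setIT -prob_fineK.
apply/integrableP; split; first exact/measurable_EFinP/measurable_indic.
under eq_integral do rewrite /= ger0_norm //.
by rewrite integral_indic // setIT (le_lt_trans (probability_le1 P mF)) ?ltry.
Qed.

Lemma mean_ge0_finite f : measurable_fun setT f -> (forall s, 0 <= f s) ->
  ('E_P[f] < +oo)%E -> has_mean f (fine 'E_P[f])%E.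
Proof.
rewrite unlock => mf f0 foo.
have e : (\int[P]_s `|(f s)%:E|)%E = (\int[P]_s (f s)%:E)%E.
  by apply: eq_integral => s _; rewrite /= ger0_norm.
split.
  by apply/integrableP; split; [exact/measurable_EFinP | rewrite e].
rewrite fineK // ge0_fin_numE //; apply: integral_ge0 => s _.
by rewrite lee_fin.
Qed.

Lemma mean_dominated f g v : measurable_fun setT f ->
  (forall s, `|f s| <= g s) -> has_mean g v ->
  has_mean f (fine (\int[P]_s (f s)%:E)%E).
Proof.
move=> mf fg [gi _].
have fi : P.-integrable setT (EFin \o f).
  apply: le_integrable gi => //; first exact/measurable_EFinP.
  by move=> s _; rewrite /= lee_fin (le_trans (fg s)) // ler_norm.
by split=> //; rewrite fineK //; exact: integrable_fin_num.
Qed.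

(** If no event of the form f in U distinguishes between P and P conditioned
    on F, then the image measures of f under both agree up to the factor P F,
    and so do the integrals. *)
Lemma mean_independent_ge0 f F m : measurable F -> (forall s, 0 <= f s) ->
  has_mean f m ->
  (forall U, measurable U -> P (f @^-1` U `&` F) = (P (f @^-1` U) * P F)%E) ->
  has_mean (fun s => f s * \1_F s) (m * fine (P F)).
Proof.
move=> mF f0 fm hind; have mf := mean_measurable fm.
pose g := fun s => f s * \1_F s : R.
have mg : measurable_fun setT g.
  by apply: measurable_funM => //; exact: measurable_indic.
have g0 s : 0 <= g s by rewrite /g mulr_ge0.
have gf s : g s <= f s.
  rewrite /g indicE; case: (s \in F); first by rewrite mulr1.
  by rewrite mulr0.
have hg : has_mean g (fine (\int[P]_s (g s)%:E)%E).
  by apply: mean_dominated fm => // s; rewrite ger0_norm.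
suff e : (\int[P]_s (g s)%:E)%E = (P F * \int[P]_s (f s)%:E)%E.
  by move: hg; rewrite e fm.2 [X in fine X]muleC (prob_fineK mF).
pose D := `]0, +oo[%classic : set R.
have mD : measurable D by exact: measurable_itv.
have pos (h : T -> R) : measurable_fun setT h -> (forall s, 0 <= h s) ->
    (\int[P]_s (h s)%:E = \int[pushforward P h]_(y in D) y%:E)%E.
  move=> mh h0; rewrite ge0_integral_pushforward //; last first.
    by move=> y; rewrite inE /D /= in_itv /= andbT lee_fin => /ltW.
  rewrite [RHS]integral_mkcond; apply: eq_integral => s _.
  rewrite patchE; case: ifPn => //= hs.
  have := h0 s; rewrite le0r => /orP[/eqP -> //|hs0].
  by move/negP: hs; case; rewrite inE /D /= in_itv /= hs0.
rewrite (pos g) // (pos f) //.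
pose c : {nonneg R} := NngNum (fine_ge0 (measure_ge0 P F)).
have cE : (P F = c%:num%:E)%E by rewrite [LHS](prob_fineK mF).
rewrite cE.
rewrite -ge0_integral_mscale //; last first.
  by move=> y; rewrite /D /= in_itv /= andbT lee_fin => /ltW.
apply: eq_measure_integral => U mU UD.
transitivity (P (f @^-1` U) * P F)%E; last by rewrite cE muleC.
rewrite -hind // /pushforward.
congr (P _); apply/seteqP; split=> s /=.
  move=> gU; have := UD _ gU; rewrite /D /= in_itv /= andbT /g indicE.
  case: (boolP (s \in F)) => [sF|]; last by rewrite mulr0 ltxx.
  by move: gU; rewrite /g indicE sF mulr1 => fU _; split=> //; rewrite inE in sF.
by move=> [fU sF]; rewrite /g indicE mem_set // mulr1.
Qed.

End means.

(** * Second moments along a Markov chain *)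

Section flow.
Variables (R : realType) (d ns : nat) (A : 'I_ns -> 'M[R]_d).

Fixpoint flow (w : nat -> 'I_ns) (t : nat) : 'M[R]_d :=
  if t is r.+1 then A (w r) *m flow w r else 1%:M.

Lemma eq_flow w1 w2 t : (forall r, (r < t)%N -> w1 r = w2 r) ->
  flow w1 t = flow w2 t.
Proof.
elim: t => //= t IH h; rewrite h // IH // => r rt; apply: h; exact: ltnW.
Qed.

End flow.

Section chain.
Context (R : realType) (disp : measure_display) (T : measurableType disp).
Variables (P : probability T R) (d ns : nat).
Variables (w : nat -> T -> 'I_ns) (nu : 'I_ns -> R) (p : 'I_ns -> 'I_ns -> R).
Hypothesis mc : markov_chain P w nu p.

Definition cylinder (h : nat -> 'I_ns) (t : nat) : set T :=
  [set s | forall r, (r <= t)%N -> w r s = h r].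

Definition extend (h : nat -> 'I_ns) (t : nat) (j : 'I_ns) (r : nat) : 'I_ns :=
  if (r <= t)%N then h r else j.

Lemma cylinder_bigcap h t :
  cylinder h t = \bigcap_(r in [set r | (r <= t)%N]) [set s | w r s = h r].
Proof. by []. Qed.

Lemma measurable_cylinder h t : measurable (cylinder h t).
Proof.
by have [m _ _] := mc; rewrite cylinder_bigcap; apply: bigcap_measurableType => r _.
Qed.

Lemma cylinder_extend h t j :
  cylinder (extend h t j) t.+1
    = [set s | (forall r, (r <= t)%N -> w r s = h r) /\ w t.+1 s = j].
Proof.
apply/seteqP; split=> s /=.
  move=> H; split; last by have := H _ (leqnn _); rewrite /extend ltnn.
  by move=> r rt; have := H r (leqW rt); rewrite /extend rt.
move=> [H1 H2] r; rewrite leq_eqVlt => /orP[/eqP ->|].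
  by rewrite /extend ltnn.
by rewrite ltnS => rt; rewrite /extend rt; exact: H1.
Qed.

Lemma prob_cylinder_extend h t j : fine (P (cylinder (extend h t j) t.+1))
  = fine (P (cylinder h t)) * p (h t) j.
Proof.
have [_ _ m] := mc; rewrite cylinder_extend m fineM //.
by rewrite fin_num_measure //; exact: measurable_cylinder.
Qed.

Lemma indic_cylinder h t s :
  \1_(cylinder h t) s = \sum_j \1_(cylinder (extend h t j) t.+1) s :> R.
Proof.
rewrite (bigD1 (w t.+1 s)) //= big1 ?addr0 => [|j /eqP jw].
  rewrite !indicE; congr (_ %:R); congr nat_of_bool; rewrite cylinder_extend.
  by apply/idP/idP; rewrite !inE /=; [split | case].
rewrite indicE memNset // => H; apply: jw.
by have := H _ (leqnn _); rewrite /extend ltnn.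
Qed.

Variables (A : 'I_ns -> 'M[R]_d) (x0 : T -> 'cV[R]_d) (Sig : 'M[R]_d).
Hypothesis x0_cylinder : forall h t a b,
  has_mean P (fun s => x0 s a 0 * x0 s b 0 * \1_(cylinder h t) s)
    (Sig a b * fine (P (cylinder h t))).

Lemma mean_quad_cylinder (M : 'M[R]_d) h t :
  has_mean P (fun s => quad M (x0 s) * \1_(cylinder h t) s)
    (\tr (M *m Sig) * fine (P (cylinder h t))).
Proof.
have -> : \tr (M *m Sig) * fine (P (cylinder h t))
    = \sum_a \sum_b M a b * (Sig b a * fine (P (cylinder h t))).
  rewrite mulr_suml; apply: eq_bigr => a _; rewrite mxE mulr_suml.
  by apply: eq_bigr => b _; rewrite mulrA.
apply: mean_eq; last first.
  by apply: mean_sum => a; apply: mean_sum => b; apply: meanZ; exact: x0_cylinder.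
move=> s /=; rewrite quadE bformE mulr_suml; apply: eq_bigr => a _.
by rewrite mulr_suml; apply: eq_bigr => b _; ring.
Qed.

(** Conditioning on the modes up to time m, the state at time m is a fixed
    matrix applied to x0, and each further step of the chain turns the family F
    of quadratic forms into its pull-back along the closed loop. *)
Lemma mean_quad_flow t : forall m h (F : 'I_ns -> 'M[R]_d),
  has_mean P
    (fun s => quad (F (w (m + t) s)) (flow A (w^~ s) (m + t) *m x0 s)
              * \1_(cylinder h m) s)
    (\tr ((flow A h m)^T *m iter t (back p A) F (h m) *m flow A h m *m Sig)
     * fine (P (cylinder h m))).
Proof.
elim: t => [|t IH] m h F.
  apply: mean_eq (mean_quad_cylinder _ _ _) => s /=.
  rewrite quad_congr addn0 indicE.
  case: (boolP (s \in cylinder h m)) => [|_]; last by rewrite !mulr0.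
  rewrite inE => H; rewrite H // (@eq_flow _ _ _ A (w^~ s) h) // => r rm.
  exact/H/ltnW.
apply: mean_eq; last first.
  have := @mean_sum _ _ _ P _ (index_enum 'I_ns) _ _
    (fun j => IH m.+1 (extend h m j) F).
  set v := (X in has_mean _ _ X) => hv.
  rewrite (_ : \tr _ * _ = v); first exact: hv.
  rewrite iterS {1}/back /expect.
  rewrite !mulmx_sumr !mulmx_suml !mulmx_sumr !mulmx_suml raddf_sum mulr_suml.
  apply: eq_bigr => j _; rewrite prob_cylinder_extend /=.
  have -> : extend h m j m = h m by rewrite /extend leqnn.
  have -> : extend h m j m.+1 = j by rewrite /extend ltnn.
  have -> : flow A (extend h m j) m = flow A h m.
    by apply: eq_flow => r rm; rewrite /extend ltnW.
  rewrite trmx_mul -!scalemxAr -!scalemxAl -scalemxAr -!scalemxAl mxtraceZ !mulmxA; ring.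
move=> s /=; rewrite [in RHS]indic_cylinder mulr_sumr; apply: eq_bigr => j _.
by rewrite addSnnS addnS.
Qed.

Lemma mean_quad_state t (F : 'I_ns -> 'M[R]_d) :
  has_mean P (fun s => quad (F (w t s)) (flow A (w^~ s) t *m x0 s))
    (pairing (iter t (back p A) F) (fun i => nu i *: Sig)).
Proof.
have [_ m0 _] := mc.
have e i : cylinder (fun=> i) 0 = [set s | w 0 s = i].
  apply/seteqP; split=> s /=; first exact.
  by move=> H r; rewrite leqn0 => /eqP ->.
have -> : pairing (iter t (back p A) F) (fun i => nu i *: Sig)
    = \sum_i \tr ((flow A (fun=> i) 0)^T *m iter t (back p A) F i
        *m flow A (fun=> i) 0 *m Sig) * fine (P (cylinder (fun=> i) 0)).
  apply: eq_bigr => i _; rewrite e m0 /= trmx1 mul1mx mulmx1.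
  by rewrite -scalemxAr mxtraceZ mulrC.
apply: mean_eq; last first.
  by apply: mean_sum => i; exact: (mean_quad_flow t 0 (fun=> i) F).
move=> s /=; rewrite -mulr_sumr -[RHS]mulr1; congr (_ * _).
rewrite (bigD1 (w 0 s)) //= big1 ?addr0 => [|j /eqP jw].
  by rewrite e indicE mem_set.
by rewrite e indicE memNset //= => h; apply: jw.
Qed.

End chain.

Section initial_state.
Context (R : realType) (disp : measure_display) (T : measurableType disp).
Variables (P : probability T R) (d ns : nat).
Variables (w : nat -> T -> 'I_ns) (nu : 'I_ns -> R) (p : 'I_ns -> 'I_ns -> R).
Hypothesis mc : markov_chain P w nu p.

Lemma cst_cylinder (v : 'cV[R]_d) h t a b :
  has_mean P (fun s => v a 0 * v b 0 * \1_(cylinder w h t) s)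
    ((v *m v^T) a b * fine (P (cylinder w h t))).
Proof.
rewrite mxE big_ord1 [v^T _ _]mxE; apply: meanZ; apply: mean_indic.
exact: (measurable_cylinder mc).
Qed.

Lemma sigma_chain_cylinder h t : sigma_chain w (cylinder w h t).
Proof.
pose G := [set E : set T | exists t i, E = [set s | w t s = i]].
have : measurable (cylinder w h t : set (g_sigma_algebraType G)).
  rewrite cylinder_bigcap; apply: bigcap_measurableType => r _.
  by apply: sub_sigma_algebra; exists r, (h r).
by [].
Qed.

Variable x0 : T -> 'cV[R]_d.
Hypothesis mx0 : measurable_state x0.
Hypothesis x0_moment : finite_second_moment P x0.
Hypothesis x0_indep : independent_of_chain P x0 w.

Lemma sigma_state_comb a b (r : R) U : measurable U ->
  sigma_state x0 ((fun s => (x0 s a 0 + r * x0 s b 0) ^+ 2) @^-1` U).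
Proof.
move=> mU.
pose G := [set E : set T | exists (a : 'I_d) (U : set R),
         measurable U /\ E = [set s | U (x0 s a 0)]].
have mc0 c : measurable_fun setT (fun s : g_sigma_algebraType G => x0 s c 0).
  move=> _ V mV; rewrite setTI.
  by apply: sub_sigma_algebra; exists c, V.
have mf : measurable_fun setT
    (fun s : g_sigma_algebraType G => (x0 s a 0 + r * x0 s b 0) ^+ 2).
  apply: measurable_funX; apply: measurable_funD => //.
  by apply: measurable_funM.
have := mf measurableT U mU; rewrite setTI; exact.
Qed.

Lemma mean_sqnorm : has_mean P (fun s => sqnorm (x0 s))
  (fine 'E_P[fun s => sqnorm (x0 s)])%E.
Proof.
apply: mean_ge0_finite => // [|s]; last exact: sqnorm_ge0.
by apply: measurable_sum => i; apply: measurable_funX.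
Qed.

Lemma coord_sqr_le (x : 'cV[R]_d) a : x a 0 ^+ 2 <= sqnorm x.
Proof.
by rewrite /sqnorm (bigD1 a) //= lerDl sumr_ge0 // => l _; exact: sqr_ge0.
Qed.

Lemma mean_coord a b :
  has_mean P (fun s => x0 s a 0 * x0 s b 0) (second_moment P x0 a b).
Proof.
have -> : second_moment P x0 a b = fine (\int[P]_s (x0 s a 0 * x0 s b 0)%:E)%E.
  rewrite mxE unlock; congr fine; apply: eq_integral => s _.
  by rewrite mxE big_ord1 mxE.
apply: mean_dominated mean_sqnorm => [|s]; first exact: measurable_funM.
have := coord_sqr_le (x0 s) a; have := coord_sqr_le (x0 s) b.
rewrite normrM -[x0 s a 0 ^+ 2]real_normK ?num_real //.
rewrite -[x0 s b 0 ^+ 2]real_normK ?num_real //.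
have := sqr_ge0 (`|x0 s a 0| - `|x0 s b 0|); rewrite sqrrB; lra.
Qed.

Lemma mean_comb a b (r : R) : exists m,
  has_mean P (fun s => (x0 s a 0 + r * x0 s b 0) ^+ 2) m.
Proof.
eexists; apply: mean_eq; last first.
  apply: meanD (mean_coord a a) _.
  apply: meanD (meanZ (2 * r) (mean_coord a b)) (meanZ (r ^+ 2) (mean_coord b b)).
by move=> s /=; ring.
Qed.

(** Products of two coordinates are differences of squares, and squares are
    nonnegative, so independence of events suffices. *)
Lemma indep_cylinder h t a b :
  has_mean P (fun s => x0 s a 0 * x0 s b 0 * \1_(cylinder w h t) s)
    (second_moment P x0 a b * fine (P (cylinder w h t))).
Proof.
set F := cylinder w h t; set c := fine (P F).
have sq r : exists m, has_mean P (fun s => (x0 s a 0 + r * x0 s b 0) ^+ 2) m /\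
    has_mean P (fun s => (x0 s a 0 + r * x0 s b 0) ^+ 2 * \1_F s) (m * c).
  have [m hm] := mean_comb a b r; exists m; split=> //.
  apply: mean_independent_ge0 hm _ => [|s|U mU]; last 2 first.
  - exact: sqr_ge0.
  - apply: x0_indep; [exact: sigma_state_comb | exact: sigma_chain_cylinder].
  exact: (measurable_cylinder mc).
have [m1 [h1 k1]] := sq 1; have [m2 [h2 k2]] := sq (-1).
have -> : second_moment P x0 a b = 1 / 4 * m1 + - (1 / 4) * m2.
  apply: mean_unique (mean_coord a b) _.
  apply: mean_eq (meanD (meanZ (1 / 4) h1) (meanZ (- (1 / 4)) h2)) => s /=.
  by field.
have -> : (1 / 4 * m1 + - (1 / 4) * m2) * c
    = 1 / 4 * (m1 * c) + - (1 / 4) * (m2 * c) by ring.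
apply: mean_eq (meanD (meanZ (1 / 4) k1) (meanZ (- (1 / 4)) k2)) => s /=.
by field.
Qed.

End initial_state.

(** * Stability, cost and occupation matrices of a policy *)

Section closed_loop.
Variables (R : realType) (d k ns : nat) (sys : mjls R d k ns).
Hypothesis hp : stochastic (trans sys).
Local Notation policy := ('M[R]_(k, \sum_(i < ns) d)).
Implicit Type K : policy.

Definition stableK K := stable (trans sys) (closedA sys K).

Definition stageQ K (i : 'I_ns) : 'M[R]_d :=
  costQ sys i + (gain K i)^T *m costR sys i *m gain K i.

Local Notation backK K := (back (trans sys) (closedA sys K)).
Local Notation fwdK K := (fwd (trans sys) (closedA sys K)).

Lemma trans_ge0 i j : 0 <= trans sys i j. Proof. by case: hp. Qed.

Lemma state_flow K x w t : state sys K x w t = flow (closedA sys K) w t *m x.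
Proof.
elim: t => [|t IH] /=; first by rewrite mul1mx.
by rewrite /control mulmxN mulmxA -mulmxBl IH !mulmxA.
Qed.

Lemma stage_cost_quad K i x : stage_cost sys K i x = quad (stageQ K i) x.
Proof.
rewrite /stage_cost /stageQ quadD quad_congr /control; congr (_ + _).
by rewrite -scaleN1r quadZv sqrrN expr1n mul1r.
Qed.

Lemma ms_mean (disp : measure_display) (T : measurableType disp)
    (P : probability T R) w nu (x : 'cV[R]_d) K t :
  markov_chain P w nu (trans sys) ->
  ('E_P[fun s => sqnorm (state sys K x (w^~ s) t)])%E
    = (\sum_i nu i * quad (iter t (backK K) (fun=> 1%:M) i) x)%:E.
Proof.
move=> mc.
have := mean_quad_state mc (closedA sys K) (cst_cylinder mc x) t (fun=> 1%:M).
rewrite (_ : pairing _ _ = \sum_i nu i * quad (iter t (backK K) (fun=> 1%:M) i) x).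
  move=> h; apply: mean_expectation; apply: mean_eq h => s /=.
  by rewrite state_flow quad1.
by apply: eq_bigr => i _; rewrite -scalemxAr mxtraceZ quad_tr.
Qed.

Lemma stable_ms K : stableK K -> ms_stabilizing sys K.
Proof.
move=> hs disp T P w nu x mc.
under eq_cvg do rewrite (ms_mean x K _ mc).
apply: cvg_EFin; first exact: nearW.
apply: cvg_sumr0 => i; apply: (@cvg_to_eq R _ (nu i * 0)); last exact: mulr0.
by apply: cvgMl_tmp; exact: hs.
Qed.

(** One chain with positive initial probabilities suffices: the mean square is
    then a sum of nonnegative contributions, one for each initial mode. *)
Lemma ms_stable (disp : measure_display) (T : measurableType disp)
    (P : probability T R) w nu K :
  markov_chain P w nu (trans sys) -> (forall i, 0 < nu i) ->
  ms_stabilizing sys K -> stableK K.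
Proof.
move=> mc nu0 hms i x.
have := hms disp T P w nu x mc; under eq_cvg do rewrite (ms_mean x K _ mc).
move=> /fine_cvg h.
have h0 t j : 0 <= quad (iter t (backK K) (fun=> 1%:M) j) x.
  exact: mean_square_ge0 trans_ge0 _ _ _.
have h2 : (nu i)^-1 * (\sum_j nu j * quad (iter t (backK K) (fun=> 1%:M) j) x)
    @[t --> \oo] --> (0 : R).
  apply: (@cvg_to_eq R _ ((nu i)^-1 * 0)); last exact: mulr0.
  by apply: cvgMl_tmp; exact: h.
apply: squeeze_cvgr (cvg_cst 0) h2; apply: nearW => t.
rewrite h0 /= ler_pdivlMl // (bigD1 i) //= lerDl sumr_ge0 // => j _.
by rewrite mulr_ge0 // ltW.
Qed.

Section stable_policy.
Variable K : policy.
Hypothesis hK : stableK K.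

Let vanishB := fun X i a b => back_vanish trans_ge0 X i a b hK.
Let linB := back_linear (trans sys) (closedA sys K).
Let psdB := @back_psd R d ns (trans sys) (closedA sys K) trans_ge0.

Lemma valueP_fix i : valueP sys K i = stageQ K i + backK K (valueP sys K) i.
Proof.
have [V hV] := affine_fixpoint_exists linB vanishB (stageQ K).
have := @xgetPex _ (fun=> 0) [set V | lyapunov_solution sys K V].
by move=> /(_ (ex_intro _ V hV)) /(_ i).
Qed.

Lemma valueP_unique V :
  (forall i, V i = stageQ K i + backK K V i) -> valueP sys K = V.
Proof. by move=> hV; apply: (affine_fixpoint_unique linB vanishB valueP_fix hV). Qed.

Hypothesis hQ : forall i, posdef (costQ sys i).
Hypothesis hR : forall i, posdef (costR sys i).

Lemma stageQ_posdef i : posdef (stageQ K i).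
Proof. by apply: posdefD => //; apply/psd_congr/posdef_psd. Qed.

Lemma valueP_psd i : psd (valueP sys K i).
Proof.
by apply: (fixpoint_psd linB vanishB psdB _ valueP_fix) => j;
  apply/posdef_psd/stageQ_posdef.
Qed.

Variables (disp : measure_display) (T : measurableType disp).
Variables (P : probability T R) (rho : 'I_ns -> R) (w : nat -> T -> 'I_ns).
Hypothesis hw : markov_chain P w rho (trans sys).
Variables (x0 : T -> 'cV[R]_d) (Sig : 'M[R]_d).
Hypothesis x0_cyl : forall h t a b,
  has_mean P (fun s => x0 s a 0 * x0 s b 0 * \1_(cylinder w h t) s)
    (Sig a b * fine (P (cylinder w h t))).

Local Notation X0 := (fun i => rho i *: Sig).

(** By monotone convergence the cost is the sum of the expected stage costs, and
    the partial sums telescope to V - back^t V, V being the value. *)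
Lemma cost_pairing : cost P x0 w sys K = (pairing (valueP sys K) X0)%:E.
Proof.
have hm t := mean_quad_state hw (closedA sys K) x0_cyl t (stageQ K).
have eQ t s : stage_cost sys K (w t s) (trajectory x0 w sys K t s)
    = quad (stageQ K (w t s)) (flow (closedA sys K) (w^~ s) t *m x0 s).
  by rewrite stage_cost_quad /trajectory state_flow.
have q0 i v : 0 <= quad (stageQ K i) v by case: (posdef_psd (stageQ_posdef i)).
rewrite /cost integral_nneseries //; last 2 first.
- move=> t; apply/measurable_EFinP.
  apply: (mean_measurable (v := pairing (iter t (backK K) (stageQ K)) X0)).
  by apply: mean_eq (hm t) => s; rewrite eQ.
- by move=> t s _; rewrite lee_fin eQ.
have h : \sum_(0 <= t < n) pairing (iter t (backK K) (stageQ K)) X0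
    @[n --> \oo] --> pairing (valueP sys K) X0.
  have e n : \sum_(0 <= t < n) pairing (iter t (backK K) (stageQ K)) X0
      = \sum_i \tr ((valueP sys K i - iter n (backK K) (valueP sys K) i) *m X0 i).
    rewrite exchange_big; apply: eq_bigr => i _.
    by rewrite -(sum_iter linB n valueP_fix) mulmx_suml raddf_sum.
  under eq_cvg do rewrite e.
  apply: cvg_sumr => i; apply: cvg_sumr => a.
  rewrite mxE; under eq_cvg do rewrite mxE.
  apply: cvg_sumr => b; apply: cvgMr_tmp.
  exact: (remainder_cvg vanishB).
rewrite (@eq_eseriesr _ _ (fun t => (pairing (iter t (backK K) (stageQ K)) X0)%:E)).
  apply: cvg_lim => //; under eq_cvg do rewrite sumEFin.
  by apply: cvg_EFin; [exact: nearW | exact: h].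
move=> t _; rewrite -(hm t).2; apply: eq_integral => s _.
by rewrite eQ.
Qed.

Lemma momentX_fwd i t : momentX P x0 w sys K i t = iter t (fwdK K) X0 i.
Proof.
apply/matrixP => a b; rewrite mxE -pairing_delta -pairing_iter_back.
have h := mean_quad_state hw (closedA sys K) x0_cyl t
   (fun j => if j == i then delta_mx b a else 0).
suff -> : ('E_P[fun s => ((trajectory x0 w sys K t s
    *m (trajectory x0 w sys K t s)^T) a b * (w t s == i)%:R)%R])%E
  = (pairing (iter t (backK K) (fun j => if j == i then delta_mx b a else 0)) X0)%:E.
  by [].
apply: mean_expectation; apply: mean_eq h => s /=.
rewrite /trajectory state_flow; case: eqP => _; last by rewrite mulr0 quad0.
by rewrite mulr1 quad_tr tr_delta_mul.
Qed.

Definition occupation K' (i : 'I_ns) : 'M[R]_d :=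
  limn (series (momentX P x0 w sys K' i)).

Let vanishF := fun X i a b => fwd_vanish trans_ge0 X i a b hK.
Let linF := fwd_linear (trans sys) (closedA sys K).

Lemma occupation_fix i : occupation K i = X0 i + fwdK K (occupation K) i.
Proof.
have [S hS] := affine_fixpoint_exists linF vanishF X0.
suff -> : occupation K = S by exact: hS.
apply/funext => j; rewrite /occupation.
have -> : series (momentX P x0 w sys K j) = (fun n => S j - iter n (fwdK K) S j).
  apply/funext => n; rewrite -(sum_iter linF n hS) /series /=.
  by apply: eq_bigr => t _; rewrite momentX_fwd.
apply: cvg_lim => //; apply: cvg_mx => a b; exact: (remainder_cvg vanishF).
Qed.

End stable_policy.

End closed_loop.

(** * Completing squares *)

Section dot.
Variable R : realType.

Definition dot n (u v : 'cV[R]_n) : R := (u^T *m v) 0 0.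

Lemma dotC n (u v : 'cV[R]_n) : dot u v = dot v u.
Proof. by rewrite /dot -[in RHS](trmxK u) -trmx_mul [RHS]mxE. Qed.

Lemma dotDr n (u v w : 'cV[R]_n) : dot u (v + w) = dot u v + dot u w.
Proof. by rewrite /dot mulmxDr mxE. Qed.

Lemma dotZr n a (u v : 'cV[R]_n) : dot u (a *: v) = a * dot u v.
Proof. by rewrite /dot -scalemxAr mxE. Qed.

Lemma dotNr n (u v : 'cV[R]_n) : dot u (- v) = - dot u v.
Proof. by rewrite /dot mulmxN mxE. Qed.

Lemma dot_mul n m (M : 'M[R]_(n, m)) u v : dot u (M *m v) = dot (M^T *m u) v.
Proof. by rewrite /dot trmx_mul trmxK mulmxA. Qed.

Lemma bform_dot n (M : 'M[R]_n) u v : bform M u v = dot u (M *m v).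
Proof. by rewrite /bform /dot mulmxA. Qed.

Lemma dotvv n (u : 'cV[R]_n) : dot u u = sqnorm u.
Proof. by rewrite -quad1 /quad mulmx1. Qed.

Lemma quad_mulT m n (M N : 'M[R]_(m, n)) v :
  quad (M^T *m N) v = dot (M *m v) (N *m v).
Proof. by rewrite quadE bform_dot -mulmxA dot_mul trmxK. Qed.

Lemma quad_add n (M : 'M[R]_n) u v : M^T = M ->
  quad M (u + v) = quad M u + 2 * dot (M *m u) v + quad M v.
Proof.
move=> sM; rewrite -[v in LHS]scale1r quadDv // mulr1 expr1n mul1r.
by rewrite bform_dot dot_mul sM.
Qed.

Lemma quad_sub n (M : 'M[R]_n) u v : M^T = M ->
  quad M (u - v) = quad M u - 2 * dot (M *m u) v + quad M v.
Proof.
move=> sM; rewrite quad_add // dotNr -(scaleN1r v) quadZv sqrrN expr1n mul1r.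
by rewrite mulrN.
Qed.

Lemma quad_opp n (M : 'M[R]_n) v : quad M (- v) = quad M v.
Proof. by rewrite -scaleN1r quadZv sqrrN expr1n mul1r. Qed.

Lemma complete_square n (G : 'M[R]_n) u z : posdef G ->
  quad G (u - invmx G *m z) = quad G u - 2 * dot z u + quad (invmx G) z.
Proof.
move=> pG; have [sG _] := pG; have uG := posdef_unit pG.
have sI : (invmx G)^T = invmx G by rewrite trmx_inv sG.
rewrite quad_sub // dot_mul sI mulKmx // dotC; congr (_ + _).
by rewrite -quad_congr sI mulVmx // mul1mx.
Qed.

Lemma sym_quad_eq n (M N : 'M[R]_n) : M^T = M -> N^T = N ->
  (forall v, quad M v = quad N v) -> M = N.
Proof.
move=> sM sN h; apply/matrixP => a b.
have := h (delta_mx a 0 + delta_mx b 0).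
rewrite !quad_add // !h -!{1}(dotC (delta_mx b 0)) -!bform_dot !bform_delta.
have -> : M b a = M a b by rewrite -{1}sM mxE.
by have -> : N b a = N a b by [rewrite -{1}sN mxE]; lra.
Qed.

Lemma psd_quad_le_tr n (M : 'M[R]_n) x : psd M -> quad M x <= \tr M * sqnorm x.
Proof.
move=> pM; have : 0 <= \tr (M *m ((sqnorm x)%:M - x *m x^T)).
  apply: psd_trM_ge0 pM _ => v.
  rewrite quadB -scalemx1 quadZ quad1 subr_ge0.
  have := quad_gram x^T v; rewrite trmxK => ->.
  rewrite [leLHS]/sqnorm big_ord1 -/(dot x v).
  have := psd_bform_le x v (psd1 R n).
  by rewrite /bform mulmx1 !quad1.
by rewrite mulmxBr linearB /= -quad_tr mul_mx_scalar mxtraceZ mulrC subr_ge0.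
Qed.

Lemma finite_lower ns n (Q : 'I_ns -> 'M[R]_n) : (forall i, posdef (Q i)) ->
  exists2 e, 0 < e & forall i v, e * sqnorm v <= quad (Q i) v.
Proof.
move=> pQ; have [e e0 he] := posdef_lower (posdef_mxdiag pQ); exists e => // i v.
by rewrite -(quad_mxdiag_embed Q) -(sqnorm_embed i v).
Qed.

End dot.

Section pairing_quad.
Variables (R : realType) (d ns : nat).
Implicit Types (F Y X : 'I_ns -> 'M[R]_d).

Lemma pairing_eq F Y X : (forall i v, quad (F i) v = quad (Y i) v) ->
  (forall i, psd (X i)) -> pairing F X = pairing Y X.
Proof.
move=> h pX; apply/eqP; rewrite eq_le; apply/andP.
by split; apply: pairing_ler => // i v; rewrite h.
Qed.

Lemma pairing_lel F X Y : (forall i v, quad (X i) v <= quad (Y i) v) ->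
  (forall i, psd (F i)) -> pairing F X <= pairing F Y.
Proof.
move=> h pF; rewrite -subr_ge0 -pairingBr; apply: sumr_ge0 => i _.
by apply: psd_trM_ge0 => // v; rewrite quadB subr_ge0.
Qed.

Lemma pairingZr a F X : pairing F (fun i => a *: X i) = a * pairing F X.
Proof.
rewrite /pairing mulr_sumr; apply: eq_bigr => i _.
by rewrite -scalemxAr mxtraceZ.
Qed.

End pairing_quad.

Section riccati.
Variables (R : realType) (d k ns : nat) (sys : mjls R d k ns).
Hypothesis hp : stochastic (trans sys).
Hypothesis hQ : forall i, posdef (costQ sys i).
Hypothesis hR : forall i, posdef (costR sys i).
Local Notation policy := ('M[R]_(k, \sum_(i < ns) d)).
Local Notation family := ('I_ns -> 'M[R]_d).
Implicit Types (K : policy) (V W : family).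
Local Notation backK K := (back (trans sys) (closedA sys K)).

Definition greedy V : policy :=
  \mxrow_(i < ns) (invmx (gramR sys V i) *m (dynB sys i)^T
       *m coupling sys V i *m dynA sys i).

Definition riccati_map V : family := fun i =>
  costQ sys i + (dynA sys i)^T *m coupling sys V i *m dynA sys i
  - (dynA sys i)^T *m coupling sys V i *m dynB sys i *m invmx (gramR sys V i)
     *m (dynB sys i)^T *m coupling sys V i *m dynA sys i.

Lemma coupling_psd V i : (forall j, psd (V j)) -> psd (coupling sys V i).
Proof. by move=> pV; apply: expect_psd => //; exact: trans_ge0. Qed.

Lemma gramR_posdef V i : (forall j, psd (V j)) -> posdef (gramR sys V i).
Proof. by move=> pV; apply: posdefD => //; apply/psd_congr/coupling_psd. Qed.

Lemma closedA_mul K i (v : 'cV_d) :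
  closedA sys K i *m v = dynA sys i *m v - dynB sys i *m (gain K i *m v).
Proof. by rewrite /closedA mulmxBl mulmxA. Qed.

(** Completing the square in the gain: the minimum over all gains of one step
    followed by V is the Riccati map, attained at the greedy gain. *)
Lemma policy_step_riccati V K i v : (forall j, psd (V j)) ->
  quad (stageQ sys K i + backK K V i) v = quad (riccati_map V i) v
    + quad (gramR sys V i) (gain K i *m v - gain (greedy V) i *m v).
Proof.
move=> pV; have pG := gramR_posdef i pV; have [sG _] := pG.
have [sE _] := coupling_psd i pV; have [sR _] := hR i.
set E := coupling sys V i in sE *; set G := gramR sys V i in pG sG *.
set B := dynB sys i; set A := dynA sys i.
set u := gain K i *m v; set x := A *m v; set z := B^T *m (E *m x).
have gE : gain (greedy V) i *m v = invmx G *m z.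
  by rewrite /gain mxrowK -!mulmxA.
have eL : quad (stageQ sys K i + backK K V i) v = quad (costQ sys i) v
    + quad (costR sys i) u + (quad E x - 2 * dot (E *m x) (B *m u) + quad E (B *m u)).
  rewrite [LHS]quadD [quad (stageQ _ _ _) _]quadD [quad (back _ _ _ _) _]quad_congr.
  by rewrite [quad (_ *m _ *m gain K i) _]quad_congr closedA_mul quad_sub.
have eR : quad (riccati_map V i) v
    = quad (costQ sys i) v + quad E x - quad (invmx G) z.
  rewrite [LHS]quadB quadD [quad (_ *m A) v]quad_congr; congr (_ + _ - _).
  have -> : A^T *m E *m B *m invmx G *m B^T *m E *m A
     = (B^T *m E *m A)^T *m invmx G *m (B^T *m E *m A).
    by rewrite !trmx_mul trmxK sE !mulmxA.
  by rewrite [LHS]quad_congr -!mulmxA.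
have eG : quad G u = quad (costR sys i) u + quad E (B *m u).
  by rewrite [LHS]quadD [quad (_ *m B) u]quad_congr.
rewrite gE complete_square // eL eR eG dot_mul; ring.
Qed.

End riccati.

(** * Existence of a solution of the Riccati equations *)

Section riccati_existence.
Variables (R : realType) (d k ns : nat) (sys : mjls R d k ns).
Hypothesis hp : stochastic (trans sys).
Hypothesis hQ : forall i, posdef (costQ sys i).
Hypothesis hR : forall i, posdef (costR sys i).
Local Notation policy := ('M[R]_(k, \sum_(i < ns) d)).
Local Notation family := ('I_ns -> 'M[R]_d).
Implicit Types (K : policy) (V W : family).
Local Notation backK K := (back (trans sys) (closedA sys K)).
Local Notation step K V := (fun i => stageQ sys K i + backK K V i).
Local Notation ric := (riccati_map sys).

Definition family_le V W := forall i v, quad (V i) v <= quad (W i) v.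

Lemma family_le_step K V W : family_le V W -> family_le (step K V) (step K W).
Proof.
move=> h i v; rewrite !quadD lerD2l !quad_back; apply: ler_sum => j _.
by rewrite ler_wpM2l // trans_ge0.
Qed.

Lemma riccati_greedy V i v : (forall j, psd (V j)) ->
  quad (ric V i) v = quad (step (greedy sys V) V i) v.
Proof.
move=> pV; rewrite (policy_step_riccati hp hR _ _ _ pV) subrr.
by rewrite [quad _ 0]/quad mulmx0 [_ 0 0]mxE addr0.
Qed.

Lemma riccati_le_step K V : (forall j, psd (V j)) -> family_le (ric V) (step K V).
Proof.
move=> pV i v; rewrite (policy_step_riccati hp hR _ _ _ pV) lerDl.
by have [_ ->] := posdef_psd (gramR_posdef hp hR i pV).
Qed.

Lemma riccati_mono V W : (forall j, psd (V j)) -> (forall j, psd (W j)) ->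
  family_le V W -> family_le (ric V) (ric W).
Proof.
move=> pV pW h i v; rewrite (riccati_greedy _ _ pW).
apply: le_trans (riccati_le_step (greedy sys W) pV i v) _.
exact: family_le_step.
Qed.

Lemma riccati_posdef V i : (forall j, psd (V j)) -> posdef (ric V i).
Proof.
move=> pV; have [sE _] := coupling_psd hp i pV.
have [sG _] := gramR_posdef hp hR i pV.
split=> [|v v0].
  rewrite /riccati_map linearB linearD /= !trmx_mul !trmxK trmx_inv sG sE.
  by have [-> _] := hQ i; rewrite !mulmxA.
rewrite riccati_greedy // quadD ltr_wpDr //; last first.
  by have [_ pQ] := stageQ_posdef (greedy sys V) hQ hR i; exact: pQ.
by have [_ ->] := back_psd (closedA sys (greedy sys V)) (trans_ge0 hp) pV i.
Qed.

Variable K0 : policy.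
Hypothesis hK0 : stableK sys K0.

Let V0 := valueP sys K0.
Let vi t := iter t ric V0.

Lemma vi_psd t i : psd (vi t i).
Proof.
elim: t i => [|t IH] i; first exact: (valueP_psd hp hK0 hQ hR).
exact/posdef_psd/riccati_posdef.
Qed.

Lemma vi_decr t : family_le (vi t.+1) (vi t).
Proof.
elim: t => [|t IH]; last exact: riccati_mono (vi_psd _) (vi_psd _) IH.
move=> i v; apply: le_trans (riccati_le_step K0 (vi_psd 0) i v) _.
by rewrite [in leRHS]/vi /= /V0 [in leRHS](valueP_fix hp hK0).
Qed.

Lemma vi_anti s t i v : (s <= t)%N -> quad (vi t i) v <= quad (vi s i) v.
Proof.
move=> /subnKC <-; elim: (t - s)%N => [|m IH]; first by rewrite addn0.
by rewrite addnS; apply: le_trans (vi_decr _ _ _) IH.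
Qed.

Let quad_lim i v := limn (fun t => quad (vi t i) v).

Lemma quad_lim_cvg i v : quad (vi t i) v @[t --> \oo] --> quad_lim i v.
Proof.
apply: nonincreasing_is_cvgn; last first.
  by exists 0 => _ [t _ <-]; case: (vi_psd t i).
by move=> s t st; exact: vi_anti.
Qed.

Let Vlim : family := fun i => \matrix_(a, b)
  (2^-1 * (quad_lim i (delta_mx a 0 + delta_mx b 0)
           - quad_lim i (delta_mx a 0) - quad_lim i (delta_mx b 0))).

Lemma Vlim_entry i a b : vi t i a b @[t --> \oo] --> Vlim i a b.
Proof.
have e t : vi t i a b = 2^-1 * (quad (vi t i) (delta_mx a 0 + delta_mx b 0)
    - quad (vi t i) (delta_mx a 0) - quad (vi t i) (delta_mx b 0)).
  have [sV _] := vi_psd t i.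
  rewrite quad_add // -{1}(dotC (delta_mx b 0)) -bform_dot bform_delta.
  have -> : vi t i b a = vi t i a b by rewrite -{1}sV mxE.
  by field.
under eq_cvg do rewrite e.
rewrite mxE; apply: cvgMl_tmp; apply: cvgB; last exact: quad_lim_cvg.
by apply: cvgB; exact: quad_lim_cvg.
Qed.

Lemma Vlim_quad i v : quad (vi t i) v @[t --> \oo] --> quad (Vlim i) v.
Proof. by apply: cvg_bform => a b; exact: Vlim_entry. Qed.

Lemma Vlim_psd i : psd (Vlim i).
Proof.
split; last first.
  by move=> v; apply: (limit_ge0 _ (@Vlim_quad i v)) => t; case: (vi_psd t i).
apply/matrixP => a b; rewrite !mxE [delta_mx b 0 + _]addrC; congr (_ * _).
by rewrite addrAC.
Qed.

Lemma Vlim_le t : family_le Vlim (vi t).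
Proof.
move=> i v; apply: (cvgr_to_le (@Vlim_quad i v)).
by exists t => // s /= ts; exact: vi_anti.
Qed.

(** Value iteration started from the value of a stabilizing policy decreases.
    For every K an iterate lies below the step under K of the preceding one, so
    that the limit V satisfies V <= step K V; taking K greedy, V <= ric V.
    Conversely ric V lies below every iterate from the first on, by
    monotonicity. *)
Lemma riccati_exists :
  exists V, (forall i, posdef (V i)) /\ riccati_solution sys V.
Proof.
have hge : family_le (ric Vlim) Vlim.
  move=> i v; apply: (cvgr_to_ge (@Vlim_quad i v)).
  exists 1%N => // -[//|t] _ /=.
  by apply: riccati_mono; [exact: Vlim_psd | exact: vi_psd | exact: Vlim_le].
have hle : family_le Vlim (ric Vlim).
  move=> i v; set K := greedy sys Vlim.
  have h : quad (step K (vi t) i) v @[t --> \oo] --> quad (step K Vlim i) v.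
    rewrite quadD; under eq_cvg do rewrite quadD.
    apply: cvgD; first exact: cvg_cst.
    rewrite quad_back; under eq_cvg do rewrite quad_back.
    by apply: cvg_sumr => j; apply: cvgMl_tmp; exact: Vlim_quad.
  rewrite (riccati_greedy _ _ Vlim_psd); apply: (cvgr_to_ge h).
  apply: nearW => t; apply: le_trans (Vlim_le t.+1 i v) _.
  exact: riccati_le_step (vi_psd t) i v.
have e i : Vlim i = ric Vlim i.
  apply: sym_quad_eq => [||v].
  - by case: (Vlim_psd i).
  - by case: (riccati_posdef i Vlim_psd).
  - by apply/eqP; rewrite eq_le hle hge.
exists Vlim; split; last exact: e.
by move=> i; rewrite e; apply: riccati_posdef; exact: Vlim_psd.
Qed.

End riccati_existence.

(** * Comparing two policies *)

Section difference.
Variables (R : realType) (d k ns : nat) (sys : mjls R d k ns).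
Hypothesis hp : stochastic (trans sys).
Hypothesis hQ : forall i, posdef (costQ sys i).
Hypothesis hR : forall i, posdef (costR sys i).
Local Notation policy := ('M[R]_(k, \sum_(i < ns) d)).
Implicit Types (K : policy).
Local Notation backK K := (back (trans sys) (closedA sys K)).
Local Notation fwdK K := (fwd (trans sys) (closedA sys K)).

Definition gram K i := gramR sys (valueP sys K) i.

Definition gain_diff K K' i : 'M[R]_(k, d) := gain K' i - gain K i.

Definition change K K' i : 'M[R]_d :=
  (gain_diff K K' i)^T *m gradL sys K i + (gradL sys K i)^T *m gain_diff K K' i
  + (gain_diff K K' i)^T *m gram K i *m gain_diff K K' i.

Lemma gram_posdef K i : stableK sys K -> posdef (gram K i).
Proof. by move=> hK; apply: gramR_posdef => // j; exact: valueP_psd. Qed.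

Lemma quad_change K K' i v : quad (change K K' i) v
  = 2 * dot (gradL sys K i *m v) (gain_diff K K' i *m v)
    + quad (gram K i) (gain_diff K K' i *m v).
Proof.
rewrite /change [LHS]quadD quad_congr [quad (_ + _) _]quadD !quad_mulT.
rewrite [dot (gain_diff _ _ _ *m _) _]dotC; ring.
Qed.

Lemma gradL_mul K i (v : 'cV_d) : gradL sys K i *m v
  = costR sys i *m (gain K i *m v)
    - (dynB sys i)^T *m (coupling sys (valueP sys K) i *m (closedA sys K i *m v)).
Proof.
rewrite /gradL /gramR mulmxBl mulmxDl -!mulmxA.
by rewrite closedA_mul !mulmxBr opprB addrA mulmxDl -!mulmxA.
Qed.

(** Expansion in gain_diff, in which gradL is the linear coefficient. *)
Lemma policy_step_change K K' i v : stableK sys K ->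
  quad (stageQ sys K' i + backK K' (valueP sys K) i) v
    = quad (valueP sys K i) v + quad (change K K' i) v.
Proof.
move=> hK; rewrite [in RHS](valueP_fix hp hK) quad_change.
have [sE _] := coupling_psd hp i (valueP_psd hp hK hQ hR).
have [sR _] := hR i.
set V := valueP sys K; set E := coupling sys V i in sE.
set u := gain_diff K K' i *m v; set x := gain K i *m v.
set B := dynB sys i; set a := closedA sys K i *m v.
have eK : gain K' i *m v = x + u by rewrite /u /x mulmxBl addrC subrK.
have eA : closedA sys K' i *m v = a - B *m u.
  by rewrite /a !closedA_mul eK mulmxDr opprD addrA.
have hs K1 : quad (stageQ sys K1 i + backK K1 V i) v = quad (costQ sys i) v
    + quad (costR sys i) (gain K1 i *m v) + quad E (closedA sys K1 i *m v).
  rewrite [LHS]quadD [quad (stageQ _ _ _) _]quadD [quad (back _ _ _ _) _]quad_congr.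
  by rewrite [quad (_ *m _ *m gain K1 i) _]quad_congr.
have eG : quad (gram K i) u = quad (costR sys i) u + quad E (B *m u).
  by rewrite [LHS]quadD [quad (_ *m dynB sys i) u]quad_congr.
have eD : dot (gradL sys K i *m v) u
    = dot (costR sys i *m x) u - dot (E *m a) (B *m u).
  by rewrite gradL_mul [in RHS]dot_mul dotC dotDr dotNr ![dot u _]dotC.
rewrite !hs eK eA quad_add // quad_sub // eG eD; ring.
Qed.

Lemma value_defect K K' i v : stableK sys K -> stableK sys K' ->
  quad (valueP sys K' i - valueP sys K i
        - backK K' (fun j => valueP sys K' j - valueP sys K j) i) v
    = quad (change K K' i) v.
Proof.
move=> hK hK'; rewrite (opB (@back_linear _ _ _ _ _)).
have e1 : quad (valueP sys K' i) v
    = quad (stageQ sys K' i) v + quad (backK K' (valueP sys K') i) v.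
  by rewrite -quadD -(valueP_fix hp hK').
have := policy_step_change K' i v hK; rewrite quadD !quadB e1.
have aux (s b' b u c : R) : s + b = u + c -> s + b' - u - (b' - b) = c.
  by move=> h; rewrite -[s](addrK b) h; ring.
exact: aux.
Qed.

Lemma stage_lower : exists2 e, 0 < e &
  forall K i v, e * sqnorm v <= quad (stageQ sys K i) v.
Proof.
have [e e0 he] := finite_lower hQ; exists e => // K i v.
rewrite quadD; apply: le_trans (he i v) _; rewrite lerDl.
by have [_ ->] := psd_congr (gain K i) (posdef_psd (hR i)).
Qed.

(** The value of K is a Lyapunov function for every policy that improves it. *)
Lemma improve_stable K K' : stableK sys K ->
  (forall i v, quad (change K K' i) v <= 0) -> stableK sys K'.
Proof.
move=> hK hc; have [e e0 he] := stage_lower.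
apply: (lyapunov_stable (trans_ge0 hp) e0 (valueP_psd hp hK hQ hR)) => i v.
have := policy_step_change K' i v hK; rewrite quadD.
by have := hc i v; have := he K' i v; lra.
Qed.

Variables (disp : measure_display) (T : measurableType disp).
Variables (P : probability T R) (rho : 'I_ns -> R) (w : nat -> T -> 'I_ns).
Hypothesis hw : markov_chain P w rho (trans sys).
Variables (x0 : T -> 'cV[R]_d) (Sig : 'M[R]_d).
Hypothesis x0_cyl : forall h t a b,
  has_mean P (fun s => x0 s a 0 * x0 s b 0 * \1_(cylinder w h t) s)
    (Sig a b * fine (P (cylinder w h t))).
Hypothesis hrho : forall i, 0 < rho i.
Hypothesis hSig : psd Sig.
Local Notation X0 := (fun i => rho i *: Sig).
Local Notation occ := (occupation sys P w x0).
Local Notation C := (rcost P x0 w sys).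

Lemma rcostE K : stableK sys K -> C K = pairing (valueP sys K) X0.
Proof. by move=> hK; rewrite /rcost (cost_pairing hp hK hQ hR hw x0_cyl). Qed.

Lemma X0_psd i : psd (X0 i).
Proof. by apply: psdZ => //; exact: ltW. Qed.

Lemma occupation_psd K : stableK sys K -> forall i, psd (occ K i).
Proof.
move=> hK; apply: (fixpoint_psd (op := fwdK K) _ _ _ X0_psd).
- exact: fwd_linear.
- by move=> X i a b; exact: (fwd_vanish (trans_ge0 hp)).
- by move=> X pX; exact: fwd_psd (trans_ge0 hp) _ pX.
- exact: (occupation_fix hp hK hw x0_cyl).
Qed.

Lemma occupation_ge K i v : stableK sys K ->
  quad (X0 i) v <= quad (occ K i) v.
Proof.
move=> hK; rewrite (occupation_fix hp hK hw x0_cyl i) quadD lerDl.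
by have [_ ->] := fwd_psd (closedA sys K) (trans_ge0 hp) (occupation_psd hK) i.
Qed.

(** Pairing with X0 = occ K' - fwdK K' (occ K') turns the difference of the two
    values into the defect of the value of K in the equation for K'. *)
Lemma cost_difference K K' : stableK sys K -> stableK sys K' ->
  C K' - C K = pairing (change K K') (occ K').
Proof.
move=> hK hK'; rewrite !rcostE // -pairingB.
set D := fun i => _; have pS := occupation_psd hK'.
have -> : pairing D X0
    = pairing (fun i => D i - backK K' D i) (occ K').
  rewrite pairingB pairing_back -pairingBr; congr (pairing _ _); apply/funext => i.
  by rewrite [X in X - _](occupation_fix hp hK' hw x0_cyl) addrK.
by apply: pairing_eq => // i v; rewrite value_defect.
Qed.

End difference.

(** * The optimal policy and the one-step estimate *)

Section arithmetic.
Variable R : realType.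

Lemma square_lower_bound (q D r z : R) :
  0 <= q - 2 * - D + r -> r <= z -> - z <= 2 * D + q.
Proof. by lra. Qed.

Lemma gap_decrease (x y z r s : R) :
  x - y <= - s -> r <= s -> x - z <= y - z - r.
Proof. by lra. Qed.

End arithmetic.

Section optimum.
Variables (R : realType) (d k ns : nat) (sys : mjls R d k ns).
Hypothesis hp : stochastic (trans sys).
Hypothesis hQ : forall i, posdef (costQ sys i).
Hypothesis hR : forall i, posdef (costR sys i).
Local Notation policy := ('M[R]_(k, \sum_(i < ns) d)).
Implicit Types (K : policy).
Local Notation backK K := (back (trans sys) (closedA sys K)).
Local Notation Kstar := (optK sys).

Section exists_stable.
Variable K0 : policy.
Hypothesis hK0 : stableK sys K0.

Lemma riccatiP_spec :
  (forall i, posdef (riccatiP sys i)) /\ riccati_solution sys (riccatiP sys).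
Proof. exact: (xgetPex (fun=> 0) (riccati_exists hp hQ hR hK0)). Qed.

Lemma riccatiP_fix i :
  riccatiP sys i = stageQ sys Kstar i + backK Kstar (riccatiP sys) i.
Proof.
have [pP hP] := riccatiP_spec; have psP j := posdef_psd (pP j).
apply: sym_quad_eq => [||v].
- by case: (pP i).
- apply: (posdef_sym (posdefD (stageQ_posdef Kstar hQ hR i) _)).
  exact: back_psd (trans_ge0 hp) _ psP _.
- by rewrite [in LHS](hP i) -[RHS](riccati_greedy hp hR i v psP).
Qed.

Lemma optK_stable : stableK sys Kstar.
Proof.
have [pP hP] := riccatiP_spec; have [e e0 he] := stage_lower hQ hR.
apply: (lyapunov_stable (trans_ge0 hp) e0 (fun i => posdef_psd (pP i))) => i v.
by rewrite [in leRHS]riccatiP_fix quadD addrAC lerDr subr_ge0.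
Qed.

Lemma valueP_optK : valueP sys Kstar = riccatiP sys.
Proof. exact: (valueP_unique hp optK_stable riccatiP_fix). Qed.

Lemma gradL_optK i : gradL sys Kstar i = 0.
Proof.
have [pP hP] := riccatiP_spec.
have uG := posdef_unit (gramR_posdef hp hR i (fun j => posdef_psd (pP j))).
by rewrite /gradL valueP_optK /gain mxrowK -!mulmxA mulKVmx // subrr.
Qed.

End exists_stable.

Variables (disp : measure_display) (T : measurableType disp).
Variables (P : probability T R) (rho : 'I_ns -> R) (w : nat -> T -> 'I_ns).
Hypothesis hw : markov_chain P w rho (trans sys).
Variables (x0 : T -> 'cV[R]_d) (Sig : 'M[R]_d).
Hypothesis x0_cyl : forall h t a b,
  has_mean P (fun s => x0 s a 0 * x0 s b 0 * \1_(cylinder w h t) s)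
    (Sig a b * fine (P (cylinder w h t))).
Hypothesis hrho : forall i, 0 < rho i.
Hypothesis hSig : psd Sig.
Local Notation X0 := (fun i => rho i *: Sig).
Local Notation occ := (occupation sys P w x0).
Local Notation C := (rcost P x0 w sys).
Variable mu : R.
Hypothesis mu_gt0 : 0 < mu.
Hypothesis hmu : forall i v, mu * sqnorm v <= quad (X0 i) v.
Local Notation chistar := (spectral_norm (chi P x0 w sys Kstar)).

Lemma quad_scalar (a : R) n (v : 'cV_n) : quad (a *: 1%:M) v = a * sqnorm v.
Proof. by rewrite quadZ quad1. Qed.

Lemma pairing_ge_mu K (F : 'I_ns -> 'M[R]_d) : stableK sys K ->
  (forall i, psd (F i)) -> mu * \sum_i \tr (F i) <= pairing F (occ K).
Proof.
move=> hK pF; have -> : mu * \sum_i \tr (F i) = pairing F (fun=> mu *: 1%:M).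
  rewrite pairingZr; congr (_ * _); apply: eq_bigr => i _.
  by rewrite mulmx1.
apply: pairing_lel pF => i v; rewrite quad_scalar.
exact: le_trans (hmu i v) (occupation_ge hp hw x0_cyl hrho hSig i v hK).
Qed.

Lemma change_optK K K0 i v : stableK sys K0 ->
  quad (change sys Kstar K i) v = quad (gram sys Kstar i) (gain_diff Kstar K i *m v).
Proof.
move=> hK0; rewrite quad_change (gradL_optK hK0) mul0mx.
by rewrite /dot trmx0 mul0mx mxE mulr0 add0r.
Qed.

(** The gradient term vanishes at the optimum, so that the suboptimality gap is
    a positive definite quadratic function of the distance to the optimum. *)
Lemma gap_lower : exists2 e, 0 < e & forall K i a b, stableK sys K ->
  e * (gain_diff Kstar K i a b) ^+ 2 <= C K - C Kstar.
Proof.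
have [e e0 he] := finite_lower hR; exists (mu * e); first by rewrite mulr_gt0.
move=> K i a b hK; have hs := optK_stable hK.
rewrite (cost_difference hp hQ hR hw x0_cyl hrho hSig hs hK).
set H := gain_diff Kstar K.
pose F j := e *: ((H j)^T *m H j).
have pF j : psd (F j).
  apply: psdZ; first exact: ltW.
  by rewrite -[X in X *m _]mulmx1; exact: psd_congr (psd1 R k).
apply: (@le_trans _ _ (pairing F (occ K))); last first.
  apply: pairing_ler (occupation_psd hp hw x0_cyl hrho hSig hK) => j v.
  rewrite (change_optK K j v hK) quadZ quad_gram -/(H j).
  rewrite /gram /gramR quadD; apply: le_trans (he j _) _; rewrite lerDl.
  have pE := coupling_psd hp j (valueP_psd hp hs hQ hR).
  by have [_ ->] := psd_congr (dynB sys j) pE.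
apply: le_trans (pairing_ge_mu hK pF); rewrite -mulrA ler_wpM2l ?(ltW mu_gt0) //.
have tr0 j : \tr (F j) = e * \sum_c \sum_r H j r c ^+ 2.
  rewrite mxtraceZ; congr (_ * _); apply: eq_bigr => c _; rewrite mxE.
  by apply: eq_bigr => r _; rewrite mxE expr2.
rewrite (bigD1 i) //= tr0 (bigD1 b) //= (bigD1 a) //= !mulrDr -!addrA lerDl.
rewrite !addr_ge0 ?mulr_ge0 ?(ltW e0) ?sumr_ge0 // => j _.
- exact: sqr_ge0.
- by apply: sumr_ge0 => r _; exact: sqr_ge0.
by rewrite tr0 mulr_ge0 ?(ltW e0) // sumr_ge0 // => c _; apply: sumr_ge0 => r _;
  exact: sqr_ge0.
Qed.

Lemma optK_optimal K : stableK sys K -> C Kstar <= C K.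
Proof.
move=> hK; have hs := optK_stable hK.
rewrite -subr_ge0 (cost_difference hp hQ hR hw x0_cyl hrho hSig hs hK).
apply: pairing_ge0 (occupation_psd hp hw x0_cyl hrho hSig hK) => i v.
rewrite (change_optK K i v hK).
by have [_ ->] := posdef_psd (gram_posdef hp hQ hR i hs).
Qed.

Lemma chistar_ge i v K0 : stableK sys K0 ->
  quad (occ Kstar i) v <= chistar * sqnorm v.
Proof.
move=> hK0; have hs := optK_stable hK0.
have pS := occupation_psd hp hw x0_cyl hrho hSig hs.
have [->|v0] := eqVneq v 0.
  by rewrite [quad _ 0]/quad mulmx0 [_ 0 0]mxE mulr_ge0 ?sqnorm_ge0 ?spectral_norm_ge0.
have d0 : (0 < \sum_(i < ns) d)%N.
  rewrite lt0n; apply: contra v0 => /eqP h; apply/eqP/matrixP => a.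
  have : (d <= \sum_(i < ns) d)%N by rewrite (bigD1 i) //= leq_addr.
  by rewrite h => dd; have := leq_trans (ltn_ord a) dd.
rewrite -(quad_mxdiag_embed (occ Kstar)) -(sqnorm_embed i v).
exact: psd_le_spectral_norm d0 (psd_mxdiag pS).
Qed.

Lemma chistar_gt0 K : (0 < d)%N -> (0 < ns)%N -> stableK sys K -> 0 < chistar.
Proof.
move=> d0 ns0 hK; have hs := optK_stable hK.
pose i0 := Ordinal ns0; pose v : 'cV[R]_d := delta_mx (Ordinal d0) 0.
have v1 : 0 < sqnorm v.
  by rewrite -quad1 quadE bform_delta mxE eqxx.
rewrite -(pmulr_lgt0 _ v1); apply: lt_le_trans (chistar_ge i0 v hK).
apply: lt_le_trans (occupation_ge hp hw x0_cyl hrho hSig i0 v hs).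
by apply: lt_le_trans (hmu i0 v); rewrite mulr_gt0.
Qed.

(** Z measures both the decrease achieved by the step and, through the completed
    square that bounds change from below, the gap to the optimum.  The decrease
    is paired with the occupation of K', which is at least mu; the gap is
    paired with that of the optimum, which is at most its spectral norm. *)
Lemma descent K K' (Z : 'I_ns -> 'M[R]_d) c b : (0 < d)%N -> (0 < ns)%N ->
  stableK sys K -> 0 < c -> 0 < b -> (forall i, psd (Z i)) ->
  (forall i v, quad (change sys K K' i) v <= - c * quad (Z i) v) ->
  (forall i v, quad (invmx (gram sys K i)) (gradL sys K i *m v)
               <= b * quad (Z i) v) ->
  stableK sys K' /\
  C K' - C Kstar <= (1 - c * mu / (b * chistar)) * (C K - C Kstar).
Proof.
move=> d0 ns0 hK c0 b0 pZ h1 h2; have hs := optK_stable hK.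
have hK' : stableK sys K'.
  apply: (improve_stable hp hQ hR hK) => i v; apply: le_trans (h1 i v) _.
  by rewrite mulNr oppr_le0 mulr_ge0 ?(ltW c0) //; case: (pZ i).
split=> //; set t := \sum_i \tr (Z i).
have chi0 := chistar_gt0 d0 ns0 hK.
have e1 : C K' - C K <= - (c * mu * t).
  rewrite (cost_difference hp hQ hR hw x0_cyl hrho hSig hK hK').
  apply: (@le_trans _ _ (pairing (fun i => - c *: Z i) (occ K'))).
    apply: pairing_ler (occupation_psd hp hw x0_cyl hrho hSig hK') => i v.
    by rewrite quadZ.
  rewrite pairingZ mulNr lerN2 -mulrA ler_wpM2l ?(ltW c0) //.
  exact: pairing_ge_mu.
have e2 : C K - C Kstar <= b * chistar * t.
  have -> : C K - C Kstar = - (C Kstar - C K) by rewrite opprB.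
  rewrite (cost_difference hp hQ hR hw x0_cyl hrho hSig hK hs).
  apply: (@le_trans _ _ (pairing (fun i => b *: Z i) (occ Kstar))).
    rewrite lerNl -mulN1r -pairingZ.
    apply: pairing_ler (occupation_psd hp hw x0_cyl hrho hSig hs) => i v.
    rewrite quad_change !quadZ mulN1r.
    set g := gradL sys K i *m v; set u := gain_diff _ _ _ *m v.
    have pG := gram_posdef hp hQ hR i hK.
    have sq := complete_square (- u) g pG.
    have [_ /(_ (- u - invmx (gram sys K i) *m g))] := posdef_psd pG.
    rewrite sq dotNr quad_opp => sq0.
    exact: square_lower_bound sq0 (h2 i v).
  rewrite pairingZ -mulrA ler_wpM2l ?(ltW b0) //.
  have -> : chistar * t = pairing Z (fun=> chistar *: 1%:M).
    rewrite pairingZr; congr (_ * _); apply: eq_bigr => i _; by rewrite mulmx1.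
  by apply: pairing_lel pZ => i v; rewrite quad_scalar; exact: chistar_ge hK.
have e3 : c * mu / (b * chistar) * (C K - C Kstar) <= c * mu * t.
  rewrite -mulrA ler_wpM2l ?mulr_ge0 ?(ltW c0) ?(ltW mu_gt0) //.
  by rewrite mulrC ler_pdivrMr ?mulr_gt0 // mulrC.
rewrite mulrBl mul1r.
exact: gap_decrease e1 e3.
Qed.

End optimum.

(** * Differentiability of the cost *)

Lemma differentiable_quadratic_error (R : realType) (m n : nat)
    (f : 'M[R]_(m, n) -> R) (K G : 'M[R]_(m, n)) (c e : R) : 0 < e ->
  (forall H, `|H| <= e -> `|f (K + H) - f K - \tr (H^T *m G)| <= c * `|H| ^+ 2) ->
  differentiable f K /\ forall H, 'd f K H = \tr (H^T *m G).
Proof.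
move=> e0 hf; pose g (H : 'M[R]_(m, n)) : R := \tr (H^T *m G).
have gl : linear g.
  move=> a X Y; rewrite /g linearD linearZ /= mulmxDl -scalemxAl.
  by rewrite linearD linearZ.
pose gL : {linear 'M[R]_(m, n) -> R} :=
  HB.pack g (GRing.isLinear.Build R _ _ _ g gl).
have gc : continuous gL.
  apply/linear_bounded_continuous/linear_boundedP.
  near=> r => X; apply: le_trans (norm_tr_le _) _; apply: le_trans (l1M _ _) _.
  rewrite l1_trmx; apply: (@le_trans _ _ ((m * n)%:R * `|X| * l1 G)).
    by rewrite ler_wpM2r ?l1_ge0 // l1_le_norm.
  rewrite mulrAC ler_wpM2r //; near: r; exact: nbhs_pinfty_ge.
have ho : f \o shift K = cst (f K) + gL +o_ (0 : 'M[R]_(m, n)) id.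
  apply/eqaddoP => a a0.
  pose r := Num.min e (a / (`|c| + 1)).
  have c1 : 0 < `|c| + 1 by rewrite ltr_wpDl.
  have r0 : 0 < r by rewrite lt_min e0 divr_gt0.
  suff h : \forall H \near (0 : 'M[R]_(m, n)),
      `|f (H + K) - (f K + g H)| <= a * `|H| by [].
  apply/nbhs_norm0P; exists r => //= H; rewrite /= lt_min => /andP[He Ha].
  have := hf H (ltW He).
  rewrite opprD addrA [H + K]addrC.
  move=> /le_trans; apply; rewrite expr2 mulrA ler_wpM2r //.
  have cc : c <= `|c| + 1 by rewrite (le_trans (ler_norm c)) // lerDl.
  apply: le_trans (ler_wpM2r (normr_ge0 H) cc) _.
  by rewrite mulrC -ler_pdivlMr // ltW.
have hd := diff_unique gc ho.
split; last by move=> H; rewrite hd.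
apply/diff_locallyP; by rewrite hd.
Unshelve. all: by end_near. Qed.

Section bounds.
Variable R : realType.

Lemma sqnorm_mul_le m n (M : 'M[R]_(m, n)) v :
  sqnorm (M *m v) <= 2 * l1 M ^+ 2 * sqnorm v.
Proof.
rewrite -quad_gram; apply: le_trans (quad_le _ _) _.
rewrite ler_wpM2r ?sqnorm_ge0 // ler_wpM2l // expr2.
by apply: le_trans (l1M _ _) _; rewrite l1_trmx.
Qed.

Lemma uniform_bound ns (f : 'I_ns -> R) : exists2 M, 0 < M & forall i, f i <= M.
Proof.
exists (1 + \sum_i `|f i|); first by rewrite ltr_pwDl // sumr_ge0.
move=> i; rewrite (bigD1 i) //= addrCA.
by rewrite (le_trans (ler_norm _)) // lerDl addr_ge0 ?sumr_ge0.
Qed.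

Lemma uniform_mul_bound ns m n (F : 'I_ns -> 'M[R]_(m, n)) :
  exists2 M, 0 < M & forall i v, sqnorm (F i *m v) <= M * sqnorm v.
Proof.
have [M M0 hM] := uniform_bound (fun i => 2 * l1 (F i) ^+ 2).
exists M => // i v; apply: le_trans (sqnorm_mul_le _ _) _.
by rewrite ler_wpM2r ?sqnorm_ge0.
Qed.

Lemma uniform_quad_bound ns n (F : 'I_ns -> 'M[R]_n) :
  exists2 M, 0 < M & forall i v, `|quad (F i) v| <= M * sqnorm v.
Proof.
have [M M0 hM] := uniform_bound (fun i => 2 * l1 (F i)).
exists M => // i v; apply: le_trans (norm_quad_le _ _) _.
by rewrite ler_wpM2r ?sqnorm_ge0.
Qed.

Lemma bform_polar n (D : 'M[R]_n) x y : D^T = D ->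
  4 * bform D x y = quad D (x + y) - quad D (x - y).
Proof. by move=> sD; rewrite quad_add // quad_sub // bform_dot dot_mul sD; ring. Qed.

(** Polarization; replacing y by y / r distributes the weight. *)
Lemma young_bform n (D : 'M[R]_n) g r x y : D^T = D ->
  (forall z, `|quad D z| <= g * sqnorm z) -> 0 < r ->
  `|2 * bform D x y| <= g * (r * sqnorm x + r^-1 * sqnorm y).
Proof.
move=> sD hD r0.
have h z : `|2 * bform D x z| <= g * (sqnorm x + sqnorm z).
  have e : 2 * (2 * bform D x z) = quad D (x + z) - quad D (x - z).
    by rewrite -bform_polar // mulrA -natrM.
  have h1 := hD (x + z); have h2 := hD (x - z).
  have e2 : sqnorm (x + z) + sqnorm (x - z) = 2 * (sqnorm x + sqnorm z).
    by rewrite -!quad1 quad_add ?trmx1 // quad_sub ?trmx1 //; ring.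
  have h3 : `|2 * (2 * bform D x z)| <= 2 * (g * (sqnorm x + sqnorm z)).
    rewrite e; apply: le_trans (ler_normB _ _) _; apply: le_trans (lerD h1 h2) _.
    by rewrite -mulrDr e2 mulrCA.
  by move: h3; rewrite normrM [`|2|]ger0_norm // ler_pM2l.
have e1 : sqnorm (r^-1 *: y) = r^-1 ^+ 2 * sqnorm y by rewrite -quad1 quadZv quad1.
have e2 : bform D x (r^-1 *: y) = r^-1 * bform D x y.
  by rewrite !bform_dot -scalemxAr dotZr.
have := h (r^-1 *: y); rewrite e1 e2 mulrCA normrM [`|r^-1|]ger0_norm; last first.
  by rewrite invr_ge0 ltW.
rewrite ler_pdivrMl // => /le_trans; apply; rewrite le_eqVlt; apply/orP; left.
by apply/eqP; field; rewrite gt_eqF.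
Qed.

Lemma young_dot n r (x y : 'cV[R]_n) : 0 < r ->
  `|2 * dot x y| <= r * sqnorm x + r^-1 * sqnorm y.
Proof.
move=> r0; have := @young_bform n 1%:M 1 r x y (trmx1 _ _) _ r0.
rewrite bform_dot mul1mx mul1r; apply=> z.
by rewrite quad1 mul1r ger0_norm ?sqnorm_ge0.
Qed.

End bounds.

Section gains.
Variables (R : realType) (d k ns : nat).
Implicit Types K H : 'M[R]_(k, \sum_(i < ns) d).

Lemma gainD K H i : gain (K + H) i = gain K i + gain H i.
Proof. by apply/matrixP => a b; rewrite !mxE. Qed.

Lemma gainZ c H i : gain (c *: H) i = c *: gain H i.
Proof. by apply/matrixP => a b; rewrite !mxE. Qed.

Lemma gainN H i : gain (- H) i = - gain H i.
Proof. by apply/matrixP => a b; rewrite !mxE. Qed.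

Lemma gain_bound : exists2 c : R, 0 < c & forall H i (v : 'cV_d),
  sqnorm (gain H i *m v) <= c * `|H| ^+ 2 * sqnorm v.
Proof.
exists (2 * (k * d)%:R ^+ 2 + 1) => [|H i v].
  by rewrite ltr_wpDl // mulr_ge0 // sqr_ge0.
apply: le_trans (sqnorm_mul_le _ _) _; rewrite ler_wpM2r ?sqnorm_ge0 //.
have h : l1 (gain H i) <= (k * d)%:R * `|H|.
  apply: le_trans (l1_le_norm _) _; rewrite ler_wpM2l //.
  rewrite [leLHS]mx_normrE; apply/bigmax_leP; split=> // -[a b] _ /=.
  by rewrite mxE; exact: entry_le_norm.
apply: (@le_trans _ _ (2 * (k * d)%:R ^+ 2 * `|H| ^+ 2)).
  by rewrite -mulrA -exprMn ler_wpM2l // lerXn2r ?nnegrE ?l1_ge0 ?mulr_ge0.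
by rewrite ler_wpM2r ?sqr_ge0 // lerDl.
Qed.

End gains.

Section arithmetic.
Variable R : realType.

Lemma small_change_bound (r l g cL cH cG q1 q2 s : R) : 0 <= r -> r <= 1 ->
  0 <= s -> 0 <= cG -> 0 <= cH -> 0 < r ->
  q1 <= r * l + r^-1 * g -> l <= cL * s -> g <= cH * r ^+ 2 * s ->
  q2 <= cG * g -> q1 + q2 <= (cL + cH + cG * cH) * r * s.
Proof.
move=> r0 r1 s0 cG0 cH0 rp h1 h2 h3 h4.
have e1 : r * l <= r * (cL * s) by rewrite ler_wpM2l.
have e2 : r^-1 * g <= r * (cH * s).
  rewrite ler_pdivrMl //; apply: le_trans h3 _.
  by rewrite le_eqVlt; apply/orP; left; apply/eqP; ring.
have e3 : cG * g <= cG * (cH * r * s).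
  rewrite ler_wpM2l //; apply: le_trans h3 _; rewrite ler_wpM2r // ler_wpM2l //.
  by rewrite expr2 ler_piMl.
have -> : (cL + cH + cG * cH) * r * s
  = r * (cL * s) + r * (cH * s) + cG * (cH * r * s) by ring.
exact: lerD (le_trans h1 (lerD e1 e2)) (le_trans h4 e3).
Qed.

Lemma decrease_half (s b v c e a x : R) : s + b = v + c -> e * x <= s ->
  c <= a * x -> a <= e / 2 -> 0 <= x -> b <= v - e / 2 * x.
Proof.
move=> h1 h2 h3 h4 x0; have h5 : a * x <= e / 2 * x by rewrite ler_wpM2r.
have h6 : e / 2 * x + e / 2 * x = e * x by rewrite -mulrDl -splitr.
by lra.
Qed.

End arithmetic.

Section gradient.
Variables (R : realType) (d k ns : nat) (sys : mjls R d k ns).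
Hypothesis hp : stochastic (trans sys).
Hypothesis hQ : forall i, posdef (costQ sys i).
Hypothesis hR : forall i, posdef (costR sys i).
Local Notation policy := ('M[R]_(k, \sum_(i < ns) d)).
Implicit Types (K H : policy).
Local Notation backK K := (back (trans sys) (closedA sys K)).
Local Notation V := (valueP sys).

Lemma gain_diff_shift K H i : gain_diff K (K + H) i = gain H i.
Proof. by rewrite /gain_diff gainD addrAC subrr add0r. Qed.

Lemma change_bound K : exists2 c, 0 < c & forall H i v, `|H| <= 1 ->
  `|quad (change sys K (K + H) i) v| <= c * `|H| * sqnorm v.
Proof.
have [cL cL0 hL] := uniform_mul_bound (gradL sys K).
have [cG cG0 hG] := uniform_quad_bound (gram sys K).
have [cH cH0 hH] := gain_bound R d k ns.
exists (cL + cH + cG * cH); first by rewrite !addr_gt0 // mulr_gt0.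
move=> H i v H1; rewrite quad_change gain_diff_shift.
apply: le_trans (ler_normD _ _) _.
have := normr_ge0 H; rewrite le0r => /orP[|H0].
  rewrite normr_eq0 => /eqP ->.
  have -> : gain (0 : policy) i = 0 by apply/matrixP => a b; rewrite !mxE.
  by rewrite mul0mx normr0 mulr0 mul0r /quad /dot !mulmx0 !mxE mulr0 normr0 addr0.
apply: (small_change_bound (l := sqnorm (gradL sys K i *m v))
  (g := sqnorm (gain H i *m v))) => //.
- exact: sqnorm_ge0.
- exact: ltW.
- exact: ltW.
- exact: young_dot.
Qed.

(** The value of K is a Lyapunov function for all policies near K.  With back
    taken for the perturbed policy, the difference D of the two values satisfies
    D - back D = change, which is O(|H|), while the value V of K satisfies
    V - back V >= (e / 2) 1; so D is bounded by a multiple of |H| V. *)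
Lemma value_perturb K : stableK sys K -> exists c e, [/\ 0 < c, 0 < e, e <= 1 &
  forall H, `|H| <= e -> stableK sys (K + H) /\
    forall i v, `|quad (V (K + H) i - V K i) v| <= c * `|H| * sqnorm v].
Proof.
move=> hK; have [a a0 ha] := change_bound K.
have [e e0 he] := stage_lower hQ hR.
have [cV cV0 hV] := uniform_quad_bound (V K).
exists (2 * a / e * cV), (Num.min 1 (e / 2 / a)); split.
- by rewrite mulr_gt0 // divr_gt0 // mulr_gt0.
- by rewrite lt_min ltr01 !divr_gt0.
- by rewrite ge_min lexx.
move=> H; rewrite le_min => /andP[H1 H2]; have r0 := normr_ge0 H.
have ar : a * `|H| <= e / 2 by rewrite mulrC -ler_pdivlMr.
have pV := valueP_psd hp hK hQ hR.
have hstep i v : quad (backK (K + H) (V K) i) v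
    <= quad (V K i) v - e / 2 * sqnorm v.
  have := policy_step_change hp hQ hR (K + H) i v hK; rewrite quadD => h.
  apply: decrease_half h (he _ _ _) _ ar (sqnorm_ge0 v).
  exact: le_trans (ler_norm _) (ha H i v H1).
have e20 : 0 < e / 2 by rewrite divr_gt0.
have hK' : stableK sys (K + H) by exact: (lyapunov_stable (trans_ge0 hp) e20 pV).
split=> //; have pV' := valueP_psd hp hK' hQ hR.
have t0 : 0 <= 2 * a / e * `|H| by rewrite mulr_ge0 // divr_ge0 ?mulr_ge0 ?ltW.
have hdefect i v : e / 2 * sqnorm v
    <= quad (V K i) v - quad (backK (K + H) (V K) i) v.
  by rewrite lerBrDr addrC -lerBrDr.
move=> i v; apply: (@le_trans _ _ (2 * a / e * `|H| * quad (V K i) v)).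
  apply: (@comparison _ _ _ _ (closedA sys (K + H)) (trans_ge0 hp) (V K)
    (fun j => V (K + H) j - V K j) _ hK') => [j|j|{i v}i v].
  - by case: (pV j).
  - by rewrite linearB /=; have [-> _] := pV j; have [-> _] := pV' j.
  rewrite (value_defect hp hQ hR i v hK hK').
  apply: le_trans (ha H i v H1) _.
  rewrite quadB; apply: le_trans (ler_wpM2l t0 (hdefect i v)).
  by rewrite le_eqVlt; apply/orP; left; apply/eqP; field; rewrite gt_eqF.
apply: le_trans (ler_wpM2l t0 (le_trans (ler_norm _) (hV i v))) _.
by rewrite le_eqVlt; apply/orP; left; apply/eqP; ring.
Qed.

End gradient.

Section expansion.
Variables (R : realType) (d k ns : nat) (sys : mjls R d k ns).
Hypothesis hp : stochastic (trans sys).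
Hypothesis hQ : forall i, posdef (costQ sys i).
Hypothesis hR : forall i, posdef (costR sys i).
Local Notation policy := ('M[R]_(k, \sum_(i < ns) d)).
Implicit Types (K H : policy).
Local Notation V := (valueP sys).

Definition linear_part K H i : 'M[R]_d :=
  (gain H i)^T *m gradL sys K i + (gradL sys K i)^T *m gain H i.

Definition value_shift K (K' : policy) : 'I_ns -> 'M[R]_d := fun i => V K' i - V K i.

Lemma quad_gram_coupling K i u : quad (gram sys K i) u
  = quad (costR sys i) u + quad (coupling sys (V K) i) (dynB sys i *m u).
Proof. by rewrite [LHS]quadD [quad (_ *m dynB sys i) u]quad_congr. Qed.

Lemma coupling_shift K (K' : policy) i : coupling sys (value_shift K K') i
  = coupling sys (V K') i - coupling sys (V K) i.
Proof.
by rewrite /coupling /value_shift -sumrB; apply: eq_bigr => j _; rewrite scalerBr.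
Qed.

Lemma quad_gram_shift K (K' : policy) i u : quad (gram sys K' i) u
  = quad (gram sys K i) u
    + quad (coupling sys (value_shift K K') i) (dynB sys i *m u).
Proof.
rewrite [LHS]quad_gram_coupling [X in _ = X + _]quad_gram_coupling.
by rewrite coupling_shift [X in _ = _ + X]quadB -addrA subrKC.
Qed.

(** Exchanging the two policies in the difference formula leaves the occupation
    of K, which does not depend on H, and moves the dependence on H into the
    value, whose variation is controlled. *)
Lemma quad_remainder K (K' : policy) H i v : stableK sys K -> stableK sys K' ->
  gain K' i = gain K i + gain H i ->
  quad (- change sys K' K i - linear_part K H i) v
    = quad (gram sys K' i) (gain H i *m v)
      - 2 * bform (coupling sys (value_shift K K') i)
              (closedA sys K i *m v) (dynB sys i *m (gain H i *m v)).
Proof.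
move=> hK hK' eKH.
have [sR _] := hR i.
have [sE _] := coupling_psd hp i (valueP_psd hp hK hQ hR).
have [sE' _] := coupling_psd hp i (valueP_psd hp hK' hQ hR).
set u := gain H i *m v; set B := dynB sys i; set a := closedA sys K i *m v.
set E := coupling sys (V K) i in sE; set E' := coupling sys (V K') i in sE'.
have eH : gain_diff K' K i *m v = - u.
  by rewrite /gain_diff eKH opprD addNKr mulNmx.
have eA : closedA sys K' i *m v = a - B *m u.
  rewrite /a !closedA_mul eKH [in LHS]mulmxDl -/u mulmxDr opprD addrA //.
have eL : dot (gradL sys K i *m v) u
    = dot (costR sys i *m (gain K i *m v)) u - bform E a (B *m u).
  rewrite gradL_mul -/B -/E -/a dotC dotDr dotNr ![dot u _]dotC; congr (_ - _).
  by rewrite bform_dot [in RHS]dot_mul sE [in RHS]dot_mul.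
have eL' : dot (gradL sys K' i *m v) u
    = dot (costR sys i *m (gain K i *m v)) u + quad (costR sys i) u
      - bform E' a (B *m u) + quad E' (B *m u).
  rewrite gradL_mul -/B -/E' eA eKH [in LHS]mulmxDl -/u.
  rewrite dotC dotDr dotNr mulmxDr dotDr mulmxBr mulmxBr dotDr dotNr.
  rewrite ![dot u (costR _ _ *m _)]dotC [dot (costR _ _ *m u) u]dotC.
  rewrite -[dot u (costR _ _ *m u)]bform_dot -quadE.
  rewrite ![dot u _]dot_mul trmxK ![dot (B *m u) _]dotC.
  rewrite -[dot (E' *m (B *m u)) _]dotC -bform_dot -quadE.
  have -> : dot (E' *m a) (B *m u) = bform E' a (B *m u).
    by rewrite bform_dot [in RHS]dot_mul sE'.
  ring.
have eP : quad (linear_part K H i) v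
    = 2 * (dot (costR sys i *m (gain K i *m v)) u - bform E a (B *m u)).
  by rewrite -eL [LHS]quadD !quad_mulT [dot (gain _ _ *m _) _]dotC -mulr2n mulr_natl.
have eC : quad (change sys K' K i) v
    = 2 * - (dot (costR sys i *m (gain K i *m v)) u + quad (costR sys i) u
             - bform E' a (B *m u) + quad E' (B *m u))
      + (quad (costR sys i) u + quad E' (B *m u)).
  rewrite quad_change eH [dot _ (- u)]dotNr [quad _ (- u)]quad_opp eL'.
  by rewrite quad_gram_coupling.
have eB : bform (E' - E) a (B *m u) = bform E' a (B *m u) - bform E a (B *m u).
  by rewrite bformD -scaleN1r bformZ mulN1r.
have aux (x r b' b q : R) : - (2 * - (x + r - b' + q) + (r + q)) - 2 * (x - b)
    = r + q - 2 * (b' - b) by ring.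
rewrite [LHS]quadB [quad (- _) v]quadN eC eP coupling_shift eB.
by rewrite quad_gram_coupling; exact: aux.
Qed.

Lemma coupling_quad_bound (D : 'I_ns -> 'M[R]_d) g i v :
  (forall j, `|quad (D j) v| <= g) -> `|quad (coupling sys D i) v| <= g.
Proof.
move=> h; rewrite /coupling quad_sum; apply: le_trans (ler_norm_sum _ _ _) _.
have -> : g = \sum_j trans sys i j * g.
  by rewrite -mulr_suml; case: hp => _ ->; rewrite mul1r.
apply: ler_sum => j _; rewrite quadZ normrM ger0_norm ?trans_ge0 //.
by rewrite ler_wpM2l ?trans_ge0.
Qed.

(** A perturbation of size r changes the value by O(r); Young's inequality with
    weight r turns the mixed term into O(r^2). *)
Lemma remainder_bound K : stableK sys K -> exists c e, [/\ 0 <= c, 0 < e &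
  forall H, `|H| <= e -> stableK sys (K + H) /\ forall i v,
    `|quad (- change sys (K + H) K i - linear_part K H i) v|
      <= c * `|H| ^+ 2 * sqnorm v].
Proof.
move=> hK; have [g [e [g0 e0 e1 hV]]] := value_perturb hp hQ hR hK.
have [cG cG0 hG] := uniform_quad_bound (gram sys K).
have [cA cA0 hA] := uniform_mul_bound (closedA sys K).
have [cB cB0 hB] := uniform_mul_bound (dynB sys).
have [cH cH0 hH] := gain_bound R d k ns.
exists (cG * cH + g * (cB * cH) + g * (cA + cB * cH)), e; split=> //.
  by rewrite !addr_ge0 ?mulr_ge0 ?addr_ge0 ?mulr_ge0 // ltW.
move=> H He; have [hK' hD] := hV H He; split=> // i v.
have r1 : `|H| <= 1 := le_trans He e1.
have r0 := normr_ge0 H; rewrite (quad_remainder _ hK hK' (gainD K H i)).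
set u := gain H i *m v; set a := closedA sys K i *m v.
have hu : sqnorm u <= cH * `|H| ^+ 2 * sqnorm v := hH H i v.
have hBu : sqnorm (dynB sys i *m u) <= cB * cH * `|H| ^+ 2 * sqnorm v.
  apply: le_trans (hB i u) _; rewrite -2!mulrA ler_wpM2l ?(ltW cB0) //.
  by rewrite mulrA; exact: hu.
have hS z : `|quad (coupling sys (value_shift K (K + H)) i) z| <= g * `|H| * sqnorm z.
  by apply: coupling_quad_bound => j; exact: hD.
have v0 := sqnorm_ge0 v.
have h1 : `|quad (gram sys (K + H) i) u|
    <= (cG * cH + g * (cB * cH)) * `|H| ^+ 2 * sqnorm v.
  rewrite (quad_gram_shift K (K + H)).
  apply: le_trans (ler_normD _ _) _; rewrite !mulrDl lerD //.
    apply: le_trans (hG i u) _; rewrite -2!mulrA ler_wpM2l ?(ltW cG0) //.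
    by rewrite mulrA; exact: hu.
  apply: le_trans (hS _) _; rewrite -mulrA -2!mulrA ler_wpM2l ?(ltW g0) //.
  by apply: le_trans (ler_piMl (sqnorm_ge0 _) r1) _; rewrite mulrA; exact: hBu.
have h2 : `|2 * bform (coupling sys (value_shift K (K + H)) i) a (dynB sys i *m u)|
    <= g * (cA + cB * cH) * `|H| ^+ 2 * sqnorm v.
  have sS : (coupling sys (value_shift K (K + H)) i)^T
      = coupling sys (value_shift K (K + H)) i.
    rewrite /coupling linear_sum; apply: eq_bigr => j _ /=.
    rewrite linearZ /= /value_shift linearB /=.
    have [-> _] := valueP_psd hp hK hQ hR j.
    by have [-> _] := valueP_psd hp hK' hQ hR j.
  move: r0; rewrite le0r => /orP[|rp].
    rewrite normr_eq0 => /eqP H0; have u0 : u = 0.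
      rewrite /u H0; have -> : gain (0 : policy) i = 0.
        by apply/matrixP => x y; rewrite !mxE.
      by rewrite mul0mx.
    by rewrite u0 /bform !mulmx0 mxE mulr0 normr0 H0 normr0 expr0n !(mulr0, mul0r).
  apply: le_trans (young_bform _ _ sS hS rp) _.
  have ha : `|H| * sqnorm a <= cA * `|H| * sqnorm v.
    by apply: le_trans (ler_wpM2l (ltW rp) (hA i v)) _; rewrite mulrA [`|H| * _]mulrC.
  have hb : `|H|^-1 * sqnorm (dynB sys i *m u) <= cB * cH * `|H| * sqnorm v.
    rewrite ler_pdivrMl //; apply: le_trans hBu _.
    by rewrite le_eqVlt; apply/orP; left; apply/eqP; ring.
  apply: (@le_trans _ _ (g * `|H| * (cA * `|H| * sqnorm v + cB * cH * `|H| * sqnorm v))).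
    by rewrite ler_wpM2l ?mulr_ge0 ?(ltW g0) // lerD.
  by rewrite le_eqVlt; apply/orP; left; apply/eqP; ring.
apply: le_trans (ler_normB _ _) _; apply: le_trans (lerD h1 h2) _.
by rewrite -!mulrDl.
Qed.

Variables (disp : measure_display) (T : measurableType disp).
Variables (P : probability T R) (rho : 'I_ns -> R) (w : nat -> T -> 'I_ns).
Hypothesis hw : markov_chain P w rho (trans sys).
Variables (x0 : T -> 'cV[R]_d) (Sig : 'M[R]_d).
Hypothesis x0_cyl : forall h t a b,
  has_mean P (fun s => x0 s a 0 * x0 s b 0 * \1_(cylinder w h t) s)
    (Sig a b * fine (P (cylinder w h t))).
Hypothesis hrho : forall i, 0 < rho i.
Hypothesis hSig : psd Sig.
Local Notation occ := (occupation sys P w x0).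
Local Notation C := (rcost P x0 w sys).

Definition gradL_row K : policy := \mxrow_(i < ns) gradL sys K i.

Lemma pairing_linear_part K H : stableK sys K ->
  pairing (linear_part K H) (occ K)
    = \tr (H^T *m ((2 *: gradL_row K) *m chi P x0 w sys K)).
Proof.
move=> hK; rewrite /chi -/(occ K) -scalemxAl -scalemxAr mxtraceZ.
have eH : H^T = \mxcol_(i < ns) (gain H i)^T by rewrite -{1}(submxrowK H) tr_mxrow.
rewrite /gradL_row mul_mxrow_mxdiag mxtrace_mulC eH.
rewrite mul_mxrow_mxcol raddf_sum mulr_sumr; apply: eq_bigr => i _ /=.
rewrite mulmxDl mxtraceD mulr_natl mulr2n.
have [sS _] := occupation_psd hp hw x0_cyl hrho hSig hK i.
congr (_ + _); first by rewrite -mulmxA mxtrace_mulC.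
rewrite -[LHS]mxtrace_tr !trmx_mul trmxK sS.
by rewrite [LHS]mxtrace_mulC -[in LHS]mulmxA [LHS]mxtrace_mulC.
Qed.

Lemma cost_expansion K : stableK sys K -> exists c e, 0 < e /\
  forall H, `|H| <= e ->
    `|C (K + H) - C K - \tr (H^T *m ((2 *: gradL_row K) *m chi P x0 w sys K))|
      <= c * `|H| ^+ 2.
Proof.
move=> hK; have [c [e [c0 e0 hc]]] := remainder_bound hK.
have pS := occupation_psd hp hw x0_cyl hrho hSig hK.
exists (c * \sum_i \tr (occ K i)), e; split=> // H He.
have [hK' hr] := hc H He.
have -> : C (K + H) - C K = pairing (fun i => - change sys (K + H) K i) (occ K).
  rewrite -opprB (cost_difference hp hQ hR hw x0_cyl hrho hSig hK' hK).
  rewrite /pairing -sumrN; apply: eq_bigr => i _; by rewrite mulNmx linearN.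
rewrite -pairing_linear_part // -pairingB.
have eb : c * (\sum_i \tr (occ K i)) * `|H| ^+ 2
    = pairing (fun=> (c * `|H| ^+ 2) *: 1%:M) (occ K).
  rewrite pairingZ mulrAC; congr (_ * _).
  by apply: eq_bigr => i _; rewrite mul1mx.
rewrite eb ler_norml; apply/andP; split.
  rewrite lerNl -mulN1r -pairingZ; apply: pairing_ler pS => i v.
  rewrite quad_scalar quadZ mulN1r; apply: le_trans (hr i v).
  by rewrite -normrN ler_norm.
apply: pairing_ler pS => i v; rewrite quad_scalar.
exact: le_trans (ler_norm _) (hr i v).
Qed.

Lemma cost_gradient K : stableK sys K -> differentiable C K /\
  gradient C K = (2 *: gradL_row K) *m chi P x0 w sys K.
Proof.
move=> hK; have [c [e [e0 h]]] := cost_expansion hK.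
have [hd hD] := differentiable_quadratic_error e0 h; split=> //.
set G := _ *m chi P x0 w sys K in hD *.
have : forall H, 'd C K H = \tr (H^T *m gradient C K).
  exact: (@xgetPex _ 0 [set G' | forall H, 'd C K H = \tr (H^T *m G')]
    (ex_intro _ G hD)).
move=> hG; apply/matrixP => a b.
have := hG (delta_mx a b); rewrite hD trmx_delta.
by rewrite !tr_delta_mul.
Qed.

End expansion.

(** * The two methods *)

Section arithmetic.
Variable R : realType.

Lemma scaled_step_decrease (a y D g : R) : 0 <= a -> D = y -> a * g <= y ->
  2 * (- a * D) + a ^+ 2 * g <= - a * y.
Proof.
move=> a0 -> h; have h2 := ler_wpM2l a0 h.
by rewrite expr2 -mulrA mulNr; lra.
Qed.

Lemma inverse_bound (s y g u : R) : 0 < s -> s * u <= y ->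
  0 <= g - 2 * (s * y) + s ^+ 2 * u -> y <= s^-1 * g.
Proof.
move=> s0 h1; have h2 := ler_wpM2l (ltW s0) h1 => h3.
by rewrite ler_pdivlMl //; move: h3; rewrite expr2 -mulrA; lra.
Qed.

Lemma finite_pos_lower ns (f : 'I_ns -> R) : (forall i, 0 < f i) ->
  exists2 r, 0 < r & forall i, r <= f i.
Proof.
move=> f0; exists (1 + \sum_i (f i)^-1)^-1 => [|i].
  by rewrite invr_gt0 ltr_pwDl // sumr_ge0 // => i _; rewrite invr_ge0 ltW.
rewrite -[leRHS]invrK lef_pV2 ?posrE ?invr_gt0 //; last first.
  by rewrite ltr_pwDl // sumr_ge0 // => j _; rewrite invr_ge0 ltW.
rewrite (bigD1 i) //= addrCA lerDl addr_ge0 // sumr_ge0 // => j _.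
by rewrite invr_ge0 ltW.
Qed.

End arithmetic.

Lemma gain_mxrow (R : realType) d k ns (F : 'I_ns -> 'M[R]_(k, d)) i :
  gain (\mxrow_(j < ns) F j) i = F i.
Proof. exact: mxrowK. Qed.

Section methods.
Variables (R : realType) (d k ns : nat) (sys : mjls R d k ns).
Hypothesis d_gt0 : (0 < d)%N.
Hypothesis k_gt0 : (0 < k)%N.
Hypothesis ns_gt0 : (0 < ns)%N.
Hypothesis hp : stochastic (trans sys).
Hypothesis hQ : forall i, posdef (costQ sys i).
Hypothesis hR : forall i, posdef (costR sys i).
Local Notation policy := ('M[R]_(k, \sum_(i < ns) d)).
Implicit Types (K H : policy).
Local Notation Kstar := (optK sys).
Variables (disp : measure_display) (T : measurableType disp).
Variables (P : probability T R) (rho : 'I_ns -> R) (w : nat -> T -> 'I_ns).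
Hypothesis hw : markov_chain P w rho (trans sys).
Variables (x0 : T -> 'cV[R]_d) (Sig : 'M[R]_d).
Hypothesis x0_cyl : forall h t a b,
  has_mean P (fun s => x0 s a 0 * x0 s b 0 * \1_(cylinder w h t) s)
    (Sig a b * fine (P (cylinder w h t))).
Hypothesis hrho : forall i, 0 < rho i.
Hypothesis hSig : psd Sig.
Local Notation X0 := (fun i => rho i *: Sig).
Local Notation occ := (occupation sys P w x0).
Local Notation C := (rcost P x0 w sys).
Variable mu : R.
Hypothesis mu_gt0 : 0 < mu.
Hypothesis hmu : forall i v, mu * sqnorm v <= quad (X0 i) v.
Local Notation chistar := (spectral_norm (chi P x0 w sys Kstar)).

(** The step moves the gain by - 2 eta G^-1 L, where change takes the value
    - 4 eta (1 - eta) L^T G^-1 L. *)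
Lemma gn_descent K eta : stableK sys K -> 0 < eta -> eta <= 1 / 2 ->
  stableK sys (gn_step sys eta K) /\
  C (gn_step sys eta K) - C Kstar
    <= (1 - 2 * eta * mu / chistar) * (C K - C Kstar).
Proof.
move=> hK e0 e1; pose Z i := (gradL sys K i)^T *m invmx (gram sys K i) *m gradL sys K i.
have pG i := gram_posdef hp hQ hR i hK.
have e20 : 0 < 2 * eta by rewrite mulr_gt0.
have := descent hp hQ hR hw x0_cyl hrho hSig mu_gt0 hmu (K' := gn_step sys eta K)
  (Z := Z) d_gt0 ns_gt0 hK e20 ltr01; rewrite mul1r; apply => [i|i v|i v].
- exact/psd_congr/posdef_psd/posdef_inv.
- have [sG _] := pG i; have uG := posdef_unit (pG i).
  have sI : (invmx (gram sys K i))^T = invmx (gram sys K i) by rewrite trmx_inv sG.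
  rewrite /Z quad_congr quad_change; set g := gradL sys K i *m v.
  have -> : gain_diff K (gn_step sys eta K) i *m v
      = - (2 * eta) *: (invmx (gram sys K i) *m g).
    rewrite /gain_diff /gn_step gainD gainN gainZ addrAC subrr add0r.
    by rewrite gain_mxrow mulNmx -scalemxAl -mulmxA scaleNr.
  rewrite dotZr quadZv sqrrN; apply: scaled_step_decrease (ltW e20) _ _.
    by rewrite -bform_dot.
  have -> : quad (gram sys K i) (invmx (gram sys K i) *m g)
      = quad (invmx (gram sys K i)) g.
    by rewrite -quad_congr sI mulVmx // mul1mx.
  apply: ler_piMl; first by case: (posdef_psd (posdef_inv (pG i))).
  by rewrite mulrC -ler_pdivlMr.
- by rewrite /Z quad_congr mul1r.
Qed.

(** The initial second moments are at least mu. *)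
Lemma trace_value_le K i : stableK sys K -> \tr (valueP sys K i) <= C K / mu.
Proof.
move=> hK; rewrite ler_pdivlMr // mulrC (rcostE hp hQ hR hw x0_cyl hK).
have pV := valueP_psd hp hK hQ hR.
apply: (@le_trans _ _ (mu * \sum_j \tr (valueP sys K j))).
  rewrite ler_wpM2l ?(ltW mu_gt0) // (bigD1 i) //= lerDl sumr_ge0 // => j _.
  have := psd_trM_ge0 (pV j) (fun v => (psd1 R d).2 v); by rewrite mulmx1.
have -> : mu * \sum_j \tr (valueP sys K j)
    = pairing (valueP sys K) (fun=> mu *: 1%:M).
  by rewrite pairingZr; congr (_ * _); apply: eq_bigr => j _; rewrite mulmx1.
by apply: pairing_lel pV => j v; rewrite quad_scalar.
Qed.

Lemma quad_gram_le K i u : stableK sys K -> quad (gram sys K i) u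
  <= (spectral_norm (hatR sys) + spectral_norm (hatB sys) ^+ 2 * C K / mu)
     * sqnorm u.
Proof.
move=> hK; have pV := valueP_psd hp hK hQ hR.
have k0 : (0 < \sum_(i < ns) k)%N by rewrite sum_nat_const card_ord muln_gt0 ns_gt0.
have hE x : quad (coupling sys (valueP sys K) i) x <= C K / mu * sqnorm x.
  apply: le_trans (ler_norm _) _; apply: (coupling_quad_bound hp) => j.
  have [_ q0] := pV j; rewrite ger0_norm //.
  apply: le_trans (psd_quad_le_tr x (pV j)) _.
  by rewrite ler_wpM2r ?sqnorm_ge0 // trace_value_le.
have C0 : 0 <= C K / mu.
  apply: le_trans (trace_value_le i hK).
  by have := psd_trM_ge0 (pV i) (fun v => (psd1 R d).2 v); rewrite mulmx1.
rewrite quad_gram_coupling mulrDl; apply: lerD.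
  rewrite -(quad_mxdiag_embed (costR sys)) -(sqnorm_embed i u).
  apply: psd_le_spectral_norm k0 _; apply: psd_mxdiag => j; exact: posdef_psd.
apply: le_trans (hE _) _.
have -> : spectral_norm (hatB sys) ^+ 2 * C K / mu * sqnorm u
    = C K / mu * (spectral_norm (hatB sys) ^+ 2 * sqnorm u).
  have aux (b c m q : R) : b * c * m * q = c * m * (b * q) by ring.
  exact: aux.
rewrite ler_wpM2l //.
rewrite -(sqnorm_embed i u) -(sqnorm_embed i (_ *m _)).
by rewrite -(block_diag_embed (dynB sys)); exact: spectral_normP.
Qed.

Lemma chi_unit K : stableK sys K -> chi P x0 w sys K \in unitmx.
Proof.
move=> hK; apply/posdef_unit/posdef_mxdiag => i.
have pS := occupation_psd hp hw x0_cyl hrho hSig hK i.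
split; first by case: pS.
move=> v v0; apply: lt_le_trans (occupation_ge hp hw x0_cyl hrho hSig i v hK).
by apply: lt_le_trans (hmu i v); rewrite mulr_gt0 // sqnorm_gt0.
Qed.

Lemma npg_stepE K eta : stableK sys K ->
  npg_step P x0 w sys eta K = K - (2 * eta) *: gradL_row sys K.
Proof.
move=> hK; rewrite /npg_step.
have [_ ->] := cost_gradient hp hQ hR hw x0_cyl hrho hSig hK.
by rewrite mulmxK ?chi_unit // scalerA mulrC.
Qed.

(** The occupation matrices cancel, and the step moves the gain by - 2 eta L.
    The step size condition bounds 2 eta G by the identity, so that change is at
    most - 2 eta L^T L; and G >= sigma_min (hatR sys) compares L^T G^-1 L, which
    governs the gap, with L^T L. *)
Lemma npg_descent K eta : stableK sys K -> 0 < eta ->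
  2 * eta * (spectral_norm (hatR sys)
             + spectral_norm (hatB sys) ^+ 2 * C K / mu) <= 1 ->
  stableK sys (npg_step P x0 w sys eta K) /\
  C (npg_step P x0 w sys eta K) - C Kstar
    <= (1 - 2 * eta * mu * sigma_min (hatR sys) / chistar) * (C K - C Kstar).
Proof.
move=> hK e0 e1; rewrite npg_stepE //; set K' := K - _.
pose Z i := (gradL sys K i)^T *m gradL sys K i.
have pG i := gram_posdef hp hQ hR i hK.
have e20 : 0 < 2 * eta by rewrite mulr_gt0.
have k0 : (0 < \sum_(i < ns) k)%N by rewrite sum_nat_const card_ord muln_gt0 ns_gt0.
have [s0 hs] := posdef_sigma_min k0 (posdef_mxdiag hR).
rewrite -/(hatR sys) in s0 hs; set s := sigma_min (hatR sys) in s0 hs *.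
have -> : 2 * eta * mu * s / chistar = 2 * eta * mu / (s^-1 * chistar).
  by rewrite invfM invrK mulrA.
have s1 : 0 < s^-1 by rewrite invr_gt0.
apply: (descent hp hQ hR hw x0_cyl hrho hSig mu_gt0 hmu (Z := Z) d_gt0 ns_gt0 hK e20 s1).
- by move=> i; rewrite /Z -[X in X *m _]mulmx1; exact: psd_congr (psd1 R k).
- move=> i v; rewrite /Z quad_gram quad_change; set g := gradL sys K i *m v.
  have -> : gain_diff K K' i *m v = - (2 * eta) *: g.
    rewrite /gain_diff /K' gainD gainN gainZ addrAC subrr add0r.
    by rewrite gain_mxrow mulNmx -scalemxAl scaleNr.
  rewrite dotZr quadZv sqrrN; apply: scaled_step_decrease (ltW e20) (dotvv g) _.
  apply: le_trans (ler_wpM2l (ltW e20) (quad_gram_le i g hK)) _.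
  by rewrite mulrA ler_piMl // sqnorm_ge0.
move=> i v; rewrite /Z quad_gram; set g := gradL sys K i *m v.
set G := gram sys K i; set u := invmx G *m g.
have [sG _] := pG i; have uG := posdef_unit (pG i).
have sI : (invmx G)^T = invmx G by rewrite trmx_inv sG.
apply: (@inverse_bound _ s _ _ (sqnorm u)) => //.
  have -> : quad (invmx G) g = quad G u.
    by rewrite /u -[RHS]quad_congr sI mulVmx // mul1mx.
  rewrite quad_gram_coupling; apply: ler_wpDr.
    by have [_ ->] := coupling_psd hp i (valueP_psd hp hK hQ hR).
  by have := hs (embed i u); rewrite sqnorm_embed quad_mxdiag_embed.
have := sqnorm_ge0 (g - s *: u).
have -> : sqnorm (g - s *: u) = sqnorm g - 2 * (s * dot g u) + s ^+ 2 * sqnorm u.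
  by rewrite -!quad1 quad_sub ?trmx1 // mul1mx dotZr quadZv.
by rewrite /u -bform_dot.
Qed.

End methods.

(** * Iteration *)

Section iteration.
Variables (R : realType) (d k ns : nat).
Local Notation policy := ('M[R]_(k, \sum_(i < ns) d)).
Variables (good : policy -> Prop) (gap : policy -> R) (step : policy -> policy).
Variables (K0 : policy) (q : R).
Hypothesis q_lt1 : q < 1.
Hypothesis gap_ge0 : forall K, good K -> 0 <= gap K.
Hypothesis good_K0 : good K0.
Hypothesis descent_step : forall K, good K -> gap K <= gap K0 ->
  good (step K) /\ gap (step K) <= q * gap K.

Lemma iterates_good n : good (iter n step K0) /\ gap (iter n step K0) <= gap K0.
Proof.
elim: n => [|n [IH1 IH2]] /=; first by [].
have [h1 h2] := descent_step IH1 IH2; split=> //.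
apply: le_trans h2 (le_trans _ IH2).
by rewrite ler_piMl ?gap_ge0 // ltW.
Qed.

Lemma iterates_geometric (r : R) n : 0 <= r -> q <= r ->
  gap (iter n step K0) <= r ^+ n * gap K0.
Proof.
move=> r0 qr; elim: n => [|n IH]; first by rewrite expr0 mul1r.
have [h1 h2] := iterates_good n; have [_ h3] := descent_step h1 h2.
apply: le_trans h3 _; apply: (@le_trans _ _ (r * gap (iter n step K0))).
  by rewrite ler_wpM2r // gap_ge0.
by rewrite exprS -mulrA ler_wpM2l.
Qed.

(** If the initial gap is positive, the first step forces q >= 0, since gaps
    are nonnegative; otherwise all gaps vanish. *)
Lemma iterates_rate n : gap (iter n step K0) <= q ^+ n * gap K0.
Proof.
have [q0|q0] := leP 0 q; first exact: iterates_geometric.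
have [h1 h2] := descent_step good_K0 (lexx _).
have g0 := gap_ge0 good_K0; have g1 := gap_ge0 h1.
have z : gap K0 = 0.
  apply/eqP; rewrite eq_le g0 andbT -(nmulr_rge0 _ q0).
  exact: le_trans g1 h2.
have [_] := iterates_good n; by rewrite z mulr0.
Qed.

Lemma iterates_gap_cvg : gap (iter n step K0) @[n --> \oo] --> (0 : R).
Proof.
pose r := Num.max q 0.
have r0 : 0 <= r by rewrite le_max lexx orbT.
have r1 : r < 1 by rewrite gt_max q_lt1 ltr01.
have h : r ^+ n * gap K0 @[n --> \oo] --> (0 : R).
  apply: (@cvg_to_eq R _ (0 * gap K0)); last exact: mul0r.
  by apply: cvgMr_tmp; apply: cvg_expr; rewrite ger0_norm.
apply: squeeze_cvgr (cvg_cst 0) h; apply: nearW => n.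
have [h1 _] := iterates_good n.
by rewrite gap_ge0 // iterates_geometric // le_max lexx.
Qed.

Lemma iterates_cvg (Kstar : policy) (e : R) : 0 < e ->
  (forall K i a b, good K -> e * (gain_diff Kstar K i a b) ^+ 2 <= gap K) ->
  iter n step K0 @[n --> \oo] --> Kstar.
Proof.
move=> e0 hgap; apply: cvg_mx => a b.
have entry (K : policy) : K a b = gain K (tagnat.sig1 b) a (tagnat.sig2 b).
  by rewrite -{1}(submxrowK K) mxE.
apply/cvgrPdist_lt => x x0.
have ex : 0 < e * x ^+ 2 by rewrite mulr_gt0 // exprn_gt0.
have /cvgr0Pnorm_lt /(_ _ ex) := iterates_gap_cvg.
apply: filterS => n hn; have [h1 _] := iterates_good n.
have := le_lt_trans (hgap _ (tagnat.sig1 b) a (tagnat.sig2 b) h1)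
  (le_lt_trans (ler_norm _) hn).
rewrite ltr_pM2l // => h.
rewrite -(@ltr_pXn2r _ 2) ?nnegrE ?(ltW x0) // real_normK ?num_real //.
have -> : Kstar a b - iter n step K0 a b
    = - gain_diff Kstar (iter n step K0) (tagnat.sig1 b) a (tagnat.sig2 b).
  rewrite (entry Kstar) (entry (iter n step K0)) /gain_diff.
  by rewrite [X in _ = - X]mxE [X in _ = - (_ + X)]mxE opprB.
by rewrite sqrrN.
Qed.

End iteration.

Section initial_moment.
Variables (R : realType) (disp : measure_display) (T : measurableType disp).
Variables (P : probability T R) (d ns : nat).

Lemma modes_nonempty (w : nat -> T -> 'I_ns) : (0 < ns)%N.
Proof.
case: ns w => // w; have e : [set: T] = set0.
  by apply/seteqP; split=> // s _; case: (w 0 s).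
have := @probability_setT _ _ _ P; rewrite e measure0 => /eqP.
by rewrite eqe eq_sym oner_eq0.
Qed.

Lemma mu_const_bound (x0 : T -> 'cV[R]_d) (rho : 'I_ns -> R) :
  (0 < d)%N -> (0 < ns)%N -> (forall i, 0 < rho i) ->
  posdef (second_moment P x0) ->
  0 < mu_const P x0 rho /\ forall i v,
    mu_const P x0 rho * sqnorm v <= quad (rho i *: second_moment P x0) v.
Proof.
move=> d0 ns0 hrho hS; have [s0 hs] := posdef_sigma_min d0 hS.
have [r r0 hr] := finite_pos_lower hrho.
have lb : lbound (range rho) r by move=> _ [i _ <-].
have i0 := Ordinal ns0.
have h1 : 0 < inf (range rho).
  by apply: lt_le_trans r0 _; apply: lb_le_inf lb; exists (rho i0), i0.
split=> [|i v]; first exact: mulr_gt0.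
rewrite quadZ /mu_const -mulrA; apply: ler_pM => //; first exact: ltW.
  by rewrite mulr_ge0 ?sqnorm_ge0 // ltW.
by apply: ge_inf; [exists r | exists i].
Qed.

End initial_moment.

(** * Linear convergence of both methods *)

Theorem theorem2 (R : realType) (d k ns : nat) (hd : (0 < d)%N) (hk : (0 < k)%N)
  (sys : mjls R d k ns)
  (hp : stochastic (trans sys))
  (hQ : forall i, posdef (costQ sys i))
  (hR : forall i, posdef (costR sys i))
  (disp : measure_display) (T : measurableType disp) (P : probability T R)
  (rho : 'I_ns -> R) (w : nat -> T -> 'I_ns)
  (hw : markov_chain P w rho (trans sys))
  (x0 : T -> 'cV[R]_d)
  (hx0 : measurable_state x0)
  (hx0_moment : finite_second_moment P x0)
  (hx0_indep : independent_of_chain P x0 w)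
  (hrho : forall i, 0 < rho i)
  (hSigma : posdef (second_moment P x0))
  (K0 : 'M[R]_(k, \sum_(i < ns) d))
  (hK0 : ms_stabilizing sys K0) :
  let C := rcost P x0 w sys in
  let Kstar := optK sys in
  let mu := mu_const P x0 rho in
  let chistar := spectral_norm (chi P x0 w sys Kstar) in
  [/\ (* K* is the global minimizer over the stabilizing policies *)
      ms_stabilizing sys Kstar /\
      (forall K, ms_stabilizing sys K ->
         (cost P x0 w sys Kstar <= cost P x0 w sys K)%E),
      (* Gauss--Newton *)
      forall eta : R, 0 < eta -> eta <= 1 / 2 ->
        let Kn := fun n => iter n (gn_step sys eta) K0 in
        [/\ forall n, [/\ ms_stabilizing sys (Kn n),
                          cost P x0 w sys (Kn n) \is a fin_num
                        & forall i, gramR sys (valueP sys (Kn n)) i \in unitmx],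
            Kn n @[n --> \oo] --> Kstar
          & forall n, C (Kn n) - C Kstar <=
              (1 - 2 * eta * mu / chistar) ^+ n * (C K0 - C Kstar)]
    & (* natural policy gradient *)
      forall eta : R, 0 < eta ->
        eta <= 1 / (2 * (spectral_norm (hatR sys)
                         + spectral_norm (hatB sys) ^+ 2 * C K0 / mu)) ->
        let Kn := fun n => iter n (npg_step P x0 w sys eta) K0 in
        [/\ forall n, [/\ ms_stabilizing sys (Kn n),
                          cost P x0 w sys (Kn n) \is a fin_num,
                          differentiable C (Kn n)
                        & chi P x0 w sys (Kn n) \in unitmx],
            Kn n @[n --> \oo] --> Kstar
          & forall n, C (Kn n) - C Kstar <=
              (1 - 2 * eta * mu * sigma_min (hatR sys) / chistar) ^+ n
              * (C K0 - C Kstar)]].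
Proof.
move=> C Kstar mu chistar.
have ns0 : (0 < ns)%N := modes_nonempty P w.
have x0_cyl := indep_cylinder hw hx0 hx0_moment hx0_indep.
have pS := posdef_psd hSigma.
have [mu0 hmu] := mu_const_bound hd ns0 hrho hSigma.
have sK0 := ms_stable hp hw hrho hK0.
have sKs : stableK sys Kstar := optK_stable hp hQ hR sK0.
have costE K : stableK sys K -> cost P x0 w sys K = (C K)%:E.
  move=> hK; rewrite /C (rcostE hp hQ hR hw x0_cyl hK).
  exact: (cost_pairing hp hK hQ hR hw x0_cyl).
have opt K : stableK sys K -> C Kstar <= C K.
  by move=> hK; exact: (optK_optimal hp hQ hR hw x0_cyl hrho pS hK).
have gap0 K : stableK sys K -> 0 <= C K - C Kstar by rewrite subr_ge0; exact: opt.
have [e e0 he] := gap_lower hp hQ hR hw x0_cyl hrho pS mu0 hmu.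
have chi0 : 0 < chistar.
  exact: (chistar_gt0 hp hQ hR hw x0_cyl hrho pS mu0 hmu hd ns0 sK0).
split.
- split=> [|K hK]; first exact: stable_ms.
  have sK := ms_stable hp hw hrho hK.
  rewrite (costE _ sK).
  rewrite (costE _ sKs).
  rewrite lee_fin.
  exact: opt.
- move=> eta eta0 eta1 Kn.
  have q1 : 1 - 2 * eta * mu / chistar < 1.
    rewrite gtrBl; apply: divr_gt0 => //; apply: mulr_gt0 => //.
    exact: mulr_gt0.
  have hstep K : stableK sys K -> C K - C Kstar <= C K0 - C Kstar ->
      stableK sys (gn_step sys eta K) /\ C (gn_step sys eta K) - C Kstar
        <= (1 - 2 * eta * mu / chistar) * (C K - C Kstar).
    by move=> hK _; apply: (gn_descent hd ns0 hp hQ hR hw x0_cyl hrho pS mu0 hmu).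
  have good n := (iterates_good q1 gap0 sK0 hstep n).1.
  split=> [n||n].
  - split; first exact/stable_ms/good.
      by rewrite (costE _ (good n)).
    by move=> i; apply: posdef_unit; exact: (gram_posdef hp hQ hR i (good n)).
  - exact: (iterates_cvg q1 gap0 sK0 hstep e0 he).
  - exact: (iterates_rate q1 gap0 sK0 hstep).
move=> eta eta0 eta1 Kn.
set D := spectral_norm (hatR sys) + spectral_norm (hatB sys) ^+ 2 * C K0 / mu in eta1.
have s0 : 0 < sigma_min (hatR sys).
  have k0 : (0 < \sum_(i < ns) k)%N by rewrite sum_nat_const card_ord muln_gt0 ns0.
  by have [] := posdef_sigma_min k0 (posdef_mxdiag hR).
have etaD : 2 * eta * D <= 1.
  (* For D <= 0 the bound on eta would be nonpositive. *)
  have D0 : 0 < 2 * D.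
    rewrite ltNge; apply/negP => D0.
    have : eta <= 0 by apply: le_trans eta1 _; rewrite div1r invr_le0.
    by rewrite leNgt eta0.
  by move: eta1; rewrite ler_pdivlMr // mulrCA mulrA.
have q1 : 1 - 2 * eta * mu * sigma_min (hatR sys) / chistar < 1.
  rewrite gtrBl; apply: divr_gt0 => //; apply: mulr_gt0 => //.
  by apply: mulr_gt0 => //; exact: mulr_gt0.
have hstep K : stableK sys K -> C K - C Kstar <= C K0 - C Kstar ->
    stableK sys (npg_step P x0 w sys eta K) /\
    C (npg_step P x0 w sys eta K) - C Kstar
      <= (1 - 2 * eta * mu * sigma_min (hatR sys) / chistar) * (C K - C Kstar).
  move=> hK hC; apply: (npg_descent hd hk ns0 hp hQ hR hw x0_cyl hrho pS mu0 hmu hK eta0).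
  apply: le_trans etaD; apply: ler_wpM2l; first by rewrite mulr_ge0 // ltW.
  rewrite lerD2l; apply: ler_wpM2r; first by rewrite invr_ge0 ltW.
  by apply: ler_wpM2l; [exact: sqr_ge0 | rewrite lerD2r in hC].
have good n := (iterates_good q1 gap0 sK0 hstep n).1.
split=> [n||n].
- split; first exact/stable_ms/good.
  + by rewrite (costE _ (good n)).
  + by have [] := cost_gradient hp hQ hR hw x0_cyl hrho pS (good n).
  + exact: (chi_unit hp hw x0_cyl hrho pS mu0 hmu (good n)).
- exact: (iterates_cvg q1 gap0 sK0 hstep e0 he).
- exact: (iterates_rate q1 gap0 sK0 hstep).
Qed.
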